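(* Let $m\ge1$. Let $\mathcal U_q$ denote $\mathcal U_q(\mathfrak{gl}(m|n))$ or $\mathcal U_q(\mathfrak{sl}(m|n))$, and when $\mathbf{char}(q)=\ell>2$ let $u_q$ denote $u_q(\mathfrak{gl}(m|n))$ or $u_q(\mathfrak{sl}(m|n))$. For every $t\in\mathbb Z_{\ge0}$ the homogeneous subspace $\Omega_q(m|n)^{(t)}$ is a $\mathcal U_q$-submodule of $\Omega_q(m|n)$, and $\Omega_q(m|n,\mathbf 1)^{(t)}$ is a $u_q$-submodule of $\Omega_q(m|n,\mathbf 1)$ when $\mathbf{char}(q)=\ell>2$. Moreover: (i) If $\mathbf{char}(q)=0$, then each submodule $\Omega_q(m|n)^{(t)}\cong V(t\omega_1)$ is a simple module generated by the highest weight vector $x^{(\mathbf t)}\otimes1$, where $\mathbf t=t\epsilon_1=(t,0,\dots,0)$. (ii) If $\mathbf{char}(q)=\ell$ $(>2)$, put $N=m(\ell-1)$. If $t=(i-1)(\ell-1)+t_i$ with $0\le t_i\le\ell-1$, $i\in I_0$, then $\Omega_q(m|n,\mathbf 1)^{(t)}\cong V((\ell-1-t_i)\omega_{i-1}+t_i\omega_i)$ is a simple module generated by the highest weight vector $x^{(\mathbf t)}\otimes1$, where $\mathbf t=(\underbrace{\ell-1,\dots,\ell-1}_{i-1},t_i,0,\dots,0)$. If $t=N+p$ with $0\le p\le n$, then $\Omega_q(m|n,\mathbf 1)^{(t)}\cong V((\ell-2)\omega_m+\omega_{m+p})$ is a simple module generated by the highest weight vector $x^{(\tau(m))}\otimes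 x_{m+1}\cdots x_{m+p}$, where $\tau(m)=(\ell-1,\dots,\ell-1)\in\mathbb Z^m$.
   Context: $\Bbbk$ is an algebraically closed field of characteristic zero, $q\in\Bbbk^\times$, $q^2\ne1$; $m,n\ge 0$ are integers, $I_0=\{1,\dots,m\}$, $I_1=\{m+1,\dots,m+n\}$, $I=I_0\cup I_1$, $J=\{1,\dots,m+n-1\}$. $[s]=\frac{q^s-q^{-s}}{q-q^{-1}}$; $q$-binomials ${s\brack r}=\prod_{i=1}^r\frac{v^{s-i+1}-v^{-s+i-1}}{v^i-v^{-i}}\in\mathbb Z[v,v^{-1}]$ are evaluated at $v=q$. $\mathbf{char}(q)$ is the least positive integer $\ell$ with $[\ell]=0$, and $0$ if none exists. For $a,b\in\mathbb Z^{m+n}$ put $a*b=\sum_{i>j}a_ib_j$; $\epsilon_i$ are the standard basis vectors. Regard $\alpha\in\mathbb Z^m$ as supported on $I_0$ and $\mu=(\mu_{m+1},\dots,\mu_{m+n})\in\{0,1\}^n$ (identified with $\mathbb Z_2^n$) as supported on $I_1$; $|\cdot|$ is the sum of the entries. Quantum Grassmann superalgebra. $\Omega_q(m|n)$ has basis $x^{(\alpha)}\otimes x^\mu$, $\alpha\in\mathbb Z_{\ge0}^m$, $\mu\in\{0,1\}^n$, with multiplication $$(x^{(\alpha)}\otimes x^\mu)(x^{(\beta)}\otimes x^\nu)=q^{\mu*\beta}\,x^{(\alpha)}x^{(\beta)}\otimes x^\mu x^\nu,$$ where $x^{(\alpha)}x^{(\beta)}=q^{\alpha*\beta}\prod_{i=1}^m{\alpha_i+\beta_i\brack\alpha_i}\,x^{(\alpha+\beta)}$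 and $x^\mu x^\nu=(-q)^{\mu*\nu}x^{\mu+\nu}$ (zero if $\mu+\nu\notin\{0,1\}^n$). If $\mathbf{char}(q)=\ell\ge3$, $\Omega_q(m|n,\mathbf 1)$ is the subalgebra spanned by those $x^{(\alpha)}\otimes x^\mu$ with all $\alpha_i\le\ell-1$. Write $x_i=x^{(\epsilon_i)}\otimes1$ for $i\in I_0$ and $x_i=1\otimes x^{\epsilon_i}$ for $i\in I_1$ (so $x^\mu=\prod_{i\in I_1}x_i^{\mu_i}$ in increasing order); as an operator, $x_i$ is left multiplication by $x_i$. For $t\ge0$, $\Omega_q^{(t)}$ is the span of the basis elements $x^{(\alpha)}\otimes x^\mu\in\Omega_q$ with $|\alpha|+|\mu|=t$, where $\Omega_q=\Omega_q(m|n)$ or $\Omega_q(m|n,\mathbf 1)$. Operators on $\Omega_q$: $\sigma_i(x^{(\alpha)}\otimes x^\mu)=q^{\alpha_i}x^{(\alpha)}\otimes x^\mu$ for $i\in I_0$; $\sigma_i(x^{(\alpha)}\otimes x^\mu)=(-q)^{\mu_i}x^{(\alpha)}\otimes x^\mu$ and $\tau_i(x^{(\alpha)}\otimes x^\mu)=(-1)^{\mu_i}x^{(\alpha)}\otimes x^\mu$ for $i\in I_1$; $\partial_i(x^{(\alpha)}\otimes x^\mu)=q^{-\epsilon_i*\alpha}x^{(\alpha-\epsilon_i)}\otimes x^\mu$ for $i\in I_0$ (zero if $\alpha_i=0$); $\partial_i(x^{(\alpha)}\otimes x^\mu)=q^{-\epsilon_i*\alpha}(-q)^{-\epsilon_i*\mu}\delta_{1,\mu_i}\,x^{(\alpha)}\otimes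 x^{\mu-\epsilon_i}$ for $i\in I_1$. Quantum superalgebra and bosonization. Put $q_i=q$ for $i\in I_0$, $q_i=q^{-1}$ for $i\in I_1$, $p(i)=\delta_{im}$. $U_q(\mathfrak{gl}(m|n))$ is generated by $E_j,F_j$ $(j\in J)$, $K_i^{\pm1}$ $(i\in I)$, where $\mathcal K_i=K_iK_{i+1}^{-1}$, with relations (whenever all indices are in range): $K_iK_j=K_jK_i$, $K_iK_i^{-1}=1=K_i^{-1}K_i$; $K_iE_j=q_i^{\delta_{ij}-\delta_{i,j+1}}E_jK_i$, $K_iF_j=q_i^{-\delta_{ij}+\delta_{i,j+1}}F_jK_i$; $E_iF_j-(-1)^{p(i)p(j)}F_jE_i=\delta_{ij}\frac{\mathcal K_i-\mathcal K_i^{-1}}{q_i-q_i^{-1}}$; $E_iE_j=E_jE_i$, $F_iF_j=F_jF_i$ for $|i-j|>1$; $E_i^2E_j-(q+q^{-1})E_iE_jE_i+E_jE_i^2=0$ for $|i-j|=1$, $i\ne m$, and likewise for $F$; $E_m^2=F_m^2=0$; $E_{m-1}E_mE_{m+1}E_m+E_mE_{m-1}E_mE_{m+1}+E_{m+1}E_mE_{m-1}E_m+E_mE_{m+1}E_mE_{m-1}-(q+q^{-1})E_mE_{m-1}E_{m+1}E_m=0$, and likewise for $F$. The bosonization $\mathcal U_q(\mathfrak{gl}(m|n))$ is generated by $U_q(\mathfrak{gl}(m|n))$ and $\sigma$ with $\sigma^2=1$, $\sigma E_j\sigma=(-1)^{p(j)}E_j$, $\sigma F_j\sigma=(-1)^{p(j)}F_j$,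 $\sigma K_i\sigma=K_i$. $\mathcal U_q(\mathfrak{sl}(m|n))$ is the analogue with $\mathcal K_j^{\pm1}$ $(j\in J)$ in place of the $K_i^{\pm1}$ (generated by $E_j,F_j,\mathcal K_j^{\pm1},\sigma$). When $\mathbf{char}(q)=\ell>2$, $u_q=\mathcal U_q/(E_i^\ell,F_i^\ell\ (m\ne i\in J),\ E_m^2,\ F_m^2,\ K_i^{2\ell}-1)$ (for $\mathfrak{sl}$, $\mathcal K_i^{2\ell}-1$). Action. $\Omega_q(m|n)$ is a $\mathcal U_q$-module, and $\Omega_q(m|n,\mathbf 1)$ a $u_q$-module, via: $E_j$ acts as $x_j\partial_{j+1}\sigma_j$ and $F_j$ as $\sigma_j^{-1}x_{j+1}\partial_j$ $(j\in J)$; $K_i$ acts as $\sigma_i$ $(i\in I_0)$ and as $(\sigma_i\tau_i)^{-1}$ $(i\in I_1)$; $\mathcal K_i=K_iK_{i+1}^{-1}$ accordingly; $\sigma$ acts by $x^{(\alpha)}\otimes x^\mu\mapsto(-1)^{|\mu|}x^{(\alpha)}\otimes x^\mu$. Weights. $\omega_i=\epsilon_1+\cdots+\epsilon_i$, $\omega_0=0$; the bilinear form is $(\epsilon_i,\epsilon_j)=\delta_{ij}$ for $i\in I_0$ and $-\delta_{ij}$ for $i\in I_1$. A highest weight vector of weight $\lambda\in\bigoplus_i\mathbb Z\epsilon_i$ is a nonzero $v$ with $E_jv=0$ $(j\in J)$ and $K_iv=q^{(\lambda,\epsilon_i)}v$ $(i\in I)$ (for $\mathfrak{sl}$: $\mathcal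 K_jv=q^{(\lambda,\epsilon_j-\epsilon_{j+1})}v$, $j\in J$); $V(\lambda)$ denotes the simple module generated by a highest weight vector of weight $\lambda$. *)

(* Defs.v *)
From HB Require Import structures.
From mathcomp Require Import all_boot all_order all_algebra.
From mathcomp Require Import finmap zify.
From mathcomp.classical Require Import boolp.
From mathcomp.multinomials Require Import monalg.

Set Implicit Arguments.
Unset Strict Implicit.
Unset Printing Implicit Defensive.

Import GRing.Theory.

Local Open Scope ring_scope.
Local Open Scope quotient_scope.

(* Quotient of a (noncommutative) ring A by the two-sided ideal generated by  *)
(* the elements x - y with R x y.  The zero ring is allowed, hence pzRing.    *)

Section QuotientRing.
Context (A : pzRingType) (R : A -> A -> Prop).

Inductive ideal_gen : A -> Prop :=
| ideal_gen0 : ideal_gen 0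
| ideal_genD a b x y z :
    R x y -> ideal_gen z -> ideal_gen (a * (x - y) * b + z).

Lemma ideal_gen_add x y : ideal_gen x -> ideal_gen y -> ideal_gen (x + y).
Proof.
by elim=> [|a b u v z Ruv _ IH] Iy; rewrite ?add0r // -addrA; constructor; auto.
Qed.

Lemma ideal_gen_mull c x : ideal_gen x -> ideal_gen (c * x).
Proof.
elim=> [|a b u v z Ruv _ IH]; first by rewrite mulr0; constructor.
by rewrite mulrDr !mulrA -(mulrA (c * a)) !mulrA; constructor.
Qed.

Lemma ideal_gen_mulr c x : ideal_gen x -> ideal_gen (x * c).
Proof.
elim=> [|a b u v z Ruv _ IH]; first by rewrite mul0r; constructor.
by rewrite mulrDl -(mulrA _ b); constructor.
Qed.

Lemma ideal_gen_opp x : ideal_gen x -> ideal_gen (- x).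
Proof. by rewrite -mulN1r; apply: ideal_gen_mull. Qed.

Lemma ideal_gen_rel x y : R x y -> ideal_gen (x - y).
Proof.
move=> Rxy; rewrite -[x - y]addr0 -[x - y]mul1r -[1 * _]mulr1.
by do 2?constructor.
Qed.

Definition ideal_equiv (x y : A) : bool := `[< ideal_gen (x - y) >].

Lemma ideal_equiv_is_equiv : equiv_class_of ideal_equiv.
Proof.
split=> [x|x y|y x z].
- by apply/asboolP; rewrite subrr; constructor.
- by apply/asboolP/asboolP => /ideal_gen_opp; rewrite opprB.
- move=> /asboolP xy /asboolP yz; apply/asboolP.
  by rewrite -(subrKA y); apply: ideal_gen_add.
Qed.

Canonical ideal_equiv_equiv := EquivRelPack ideal_equiv_is_equiv.

Definition quot_ring := {eq_quot ideal_equiv}.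

HB.instance Definition _ := EqQuotient.on quot_ring.
HB.instance Definition _ := Choice.on quot_ring.

Lemma quot_eqP (x y : A) :
  reflect (ideal_gen (x - y)) (x == y %[mod quot_ring]).
Proof. by rewrite eqmodE; apply: asboolP. Qed.

Definition quot_add := lift_op2 quot_ring +%R.
Definition quot_opp := lift_op1 quot_ring -%R.
Definition quot_mul := lift_op2 quot_ring *%R.

Lemma pi_quot_opp : {morph \pi_quot_ring : x / - x >-> quot_opp x}.
Proof.
move=> x; unlock quot_opp; apply/eqP/quot_eqP.
by rewrite -opprD; apply: ideal_gen_opp; apply/quot_eqP; rewrite reprK.
Qed.
Canonical pi_quot_opp_morph := PiMorph1 pi_quot_opp.

Lemma pi_quot_add : {morph \pi_quot_ring : x y / x + y >-> quot_add x y}.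
Proof.
move=> x y; unlock quot_add; apply/eqP/quot_eqP.
by rewrite opprD addrACA; apply: ideal_gen_add; apply/quot_eqP; rewrite reprK.
Qed.
Canonical pi_quot_add_morph := PiMorph2 pi_quot_add.

Lemma pi_quot_mul : {morph \pi_quot_ring : x y / x * y >-> quot_mul x y}.
Proof.
move=> x y; unlock quot_mul; apply/eqP/quot_eqP.
set x' := repr _; set y' := repr _.
rewrite -(subrKA (x * y')) -mulrBr -mulrBl; apply: ideal_gen_add.
  by apply: ideal_gen_mull; apply/quot_eqP; rewrite reprK.
by apply: ideal_gen_mulr; apply/quot_eqP; rewrite reprK.
Qed.
Canonical pi_quot_mul_morph := PiMorph2 pi_quot_mul.

Fact quot_addA : associative quot_add.
Proof. by move=> x y z; rewrite -[x]reprK -[y]reprK -[z]reprK !piE addrA. Qed.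
Fact quot_addC : commutative quot_add.
Proof. by move=> x y; rewrite -[x]reprK -[y]reprK !piE addrC. Qed.
Fact quot_add0 : left_id (\pi_quot_ring 0) quot_add.
Proof. by move=> x; rewrite -[x]reprK !piE add0r. Qed.
Fact quot_addN : left_inverse (\pi_quot_ring 0) quot_opp quot_add.
Proof. by move=> x; rewrite -[x]reprK !piE addNr. Qed.

HB.instance Definition _ :=
  GRing.isZmodule.Build quot_ring quot_addA quot_addC quot_add0 quot_addN.

Fact quot_mulA : associative quot_mul.
Proof. by move=> x y z; rewrite -[x]reprK -[y]reprK -[z]reprK !piE mulrA. Qed.
Fact quot_mul1 : left_id (\pi_quot_ring 1) quot_mul.
Proof. by move=> x; rewrite -[x]reprK !piE mul1r. Qed.
Fact quot_mulr1 : right_id (\pi_quot_ring 1) quot_mul.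
Proof. by move=> x; rewrite -[x]reprK !piE mulr1. Qed.
Fact quot_mulDl : left_distributive quot_mul +%R.
Proof.
move=> x y z; rewrite /GRing.add /= -[x]reprK -[y]reprK -[z]reprK.
by rewrite !piE mulrDl.
Qed.
Fact quot_mulDr : right_distributive quot_mul +%R.
Proof.
move=> x y z; rewrite /GRing.add /= -[x]reprK -[y]reprK -[z]reprK.
by rewrite !piE mulrDr.
Qed.

HB.instance Definition _ := GRing.Zmodule_isPzRing.Build quot_ring
  quot_mulA quot_mul1 quot_mulr1 quot_mulDl quot_mulDr.

Definition quot_pi (x : A) : quot_ring := \pi_quot_ring x.

Lemma quot_piD : {morph quot_pi : x y / x + y}.
Proof. exact: pi_quot_add. Qed.

Lemma quot_piM : {morph quot_pi : x y / x * y}.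
Proof. exact: pi_quot_mul. Qed.

Lemma quot_pi1 : quot_pi 1 = 1. Proof. by []. Qed.

Lemma quot_pi_rel x y : R x y -> quot_pi x = quot_pi y.
Proof. by move=> Rxy; apply/eqP/quot_eqP/ideal_gen_rel. Qed.

End QuotientRing.

(* A U-module structure on an abelian group V, as data. *)

Record module_on (U : pzRingType) (V : zmodType) := ModuleOn {
  act :> U -> V -> V;
  actA : forall a b v, act a (act b v) = act (a * b) v;
  act1 : left_id 1 act;
  actDr : right_distributive act +%R;
  actDl : forall v, {morph act^~ v : a b / a + b} }.

Definition mod_of (U : pzRingType) (V : zmodType) (rho : module_on U V) : Type :=
  V.

HB.instance Definition _ U V (rho : module_on U V) :=
  GRing.Zmodule.on (mod_of rho).
HB.instance Definition _ U V (rho : module_on U V) :=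
  GRing.Zmodule_isLmodule.Build U (mod_of rho)
    (actA rho) (act1 rho) (actDr rho) (actDl rho).

Section Modules.
Context (U : pzRingType) (M : lmodType U).
Implicit Types (S T : {pred M}) (v : M).

Definition simple_submod S : Prop :=
  [/\ submod_closed S,
      exists2 v, v \in S & v != 0
    & forall T, submod_closed T -> {subset T <= S} -> T =i pred1 0 \/ T =i S].

Definition generated_by S v : Prop := forall u, u \in S <-> exists a : U, u = a *: v.

End Modules.

Inductive gtype := GL | SL.

(* I = {1,...,m+n} is 'I_(m + n), the ordinal i standing for the index i + 1, *)
(* so that I_0 is given by i < m; J = {1,...,m+n-1} is 'I_(m + n).-1.         *)

Section Indices.
Context (m n : nat).

Definition lo (j : 'I_(m + n).-1) : 'I_(m + n) := widen_ord (leq_pred _) j.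

Fact hi_subproof (j : 'I_(m + n).-1) : (j.+1 < m + n)%N.
Proof. by rewrite -ltn_predRL. Qed.

Definition hi (j : 'I_(m + n).-1) : 'I_(m + n) := Ordinal (hi_subproof j).

Definition odd_node (j : 'I_(m + n).-1) : bool := j.+1 == m.

Definition weight := {ffun 'I_(m + n) -> int}.

Definition eps (i : 'I_(m + n)) : weight := [ffun k => (k == i)%:Z].

(* omega_r = epsilon_1 + ... + epsilon_r *)
Definition omega (r : nat) : weight := [ffun k : 'I_(m + n) => (k < r)%N%:Z].

Definition wform (a b : weight) : int :=
  \sum_(i < m + n) (if (i < m)%N then a i * b i else - (a i * b i)).

(* a * b = \sum_(i > j) a_i b_j *)
Definition star (a b : weight) : int :=
  \sum_(i < m + n) \sum_(j < m + n | (j < i)%N) a i * b j.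

(* Labels of the Cartan generators: K_i (i in I) for gl, calK_j (j in J) for sl. *)
Definition cartan (g : gtype) : Type :=
  'I_(if g is GL then m + n else (m + n).-1).

HB.instance Definition _ g := Finite.on (cartan g).

Definition cartan_wt (g : gtype) : cartan g -> weight :=
  match g with GL => fun i => eps i | SL => fun j => eps (lo j) - eps (hi j) end.

End Indices.

Inductive gen (m n : nat) (g : gtype) :=
| gE of 'I_(m + n).-1
| gF of 'I_(m + n).-1
| gK of cartan m n g
| gKinv of cartan m n g
| gSigma.
Arguments gE {m n g}. Arguments gF {m n g}. Arguments gK {m n g}.
Arguments gKinv {m n g}. Arguments gSigma {m n g}.

HB.instance Definition _ m n g := gen_eqMixin (gen m n g).
HB.instance Definition _ m n g := gen_choiceMixin (gen m n g).

Definition qnum (k : fieldType) (q : k) (s : nat) : k :=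
  (q ^+ s - q ^- s) / (q - q^-1).

Definition is_qchar (k : fieldType) (q : k) (l : nat) : Prop :=
  if l is 0%N then forall s, (0 < s)%N -> qnum q s != 0
  else qnum q l = 0 /\ forall s, (0 < s < l)%N -> qnum q s != 0.

(* The quantum binomial [s, r], for 0 <= r <= s.  Clearing the powers of v,   *)
(*   [s, r] = v^(- r(s - r)) * \prod_(1 <= i <= r)                            *)
(*              (v^(2(s - i + 1)) - 1) / (v^(2i) - 1),                        *)
(* where the product is a polynomial: it is computed by an exact division in  *)
(* k[v] (qbin_den_dvd), and only then evaluated at v = q, which may be a root *)
(* of unity.                                                                  *)
Definition qbin_num (k : fieldType) (s r : nat) : {poly k} :=
  \prod_(1 <= i < r.+1) ('X^(2 * (s - i + 1)) - 1).
Definition qbin_den (k : fieldType) (r : nat) : {poly k} :=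
  \prod_(1 <= i < r.+1) ('X^(2 * i) - 1).

Lemma qbin_den_dvd (k : fieldType) (s r : nat) :
  (r <= s)%N -> qbin_den k r %| qbin_num k s r.
Proof.
have numS t u : (u <= t)%N ->
    qbin_num k t.+1 u.+1 = ('X^(2 * t.+1) - 1) * qbin_num k t u.
  by move=> le_ut; rewrite /qbin_num big_nat_recl // subSS subn0 addn1.
have numr t u : (u < t)%N ->
    qbin_num k t u.+1 = qbin_num k t u * ('X^(2 * (t - u)) - 1).
  move=> lt_ut; rewrite !/qbin_num big_nat_recr //=; congr (_ * ('X^(2 * _) - 1)).
  by lia.
have denS u : qbin_den k u.+1 = qbin_den k u * ('X^(2 * u.+1) - 1).
  by rewrite !/qbin_den big_nat_recr.
elim: s r => [|s IHs] [|r] //; rewrite ?ltnS => le_rs.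
- by rewrite /qbin_den big_geq // dvd1p.
- by rewrite /qbin_den big_geq // dvd1p.
have dvd_r := IHs r le_rs; rewrite numS //.
have -> : 'X^(2 * s.+1) - 1 =
    'X^(2 * r.+1) * ('X^(2 * (s - r)) - 1) + ('X^(2 * r.+1) - 1) :> {poly k}.
  rewrite mulrBr mulr1 subrKA -exprD; congr ('X^_ - 1); lia.
rewrite mulrDl dvdp_add //; last by rewrite denS mulrC dvdp_mul.
rewrite -mulrA dvdp_mull //.
move: le_rs; rewrite leq_eqVlt => /predU1P[->|lt_rs].
  by rewrite subnn muln0 expr0 subrr mul0r dvdp0.
by rewrite mulrC -numr // IHs.
Qed.

Definition qbin (k : fieldType) (q : k) (s r : nat) : k :=
  q ^- (r * (s - r)) * (qbin_num k s r %/ qbin_den k r).[q].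

Section QuantumSuperalgebra.
Context (k : fieldType) (q : k) (m n : nat) (g : gtype).

Notation J := 'I_(m + n).-1.

Definition free_alg := {malg k[{fmonom (gen m n g)}]}.

HB.instance Definition _ := GRing.PzRing.on free_alg.
HB.instance Definition _ := GRing.Lmodule.on free_alg.

Definition fgen (x : gen m n g) : free_alg := << fmu x >>.

Definition fscal (c : k) : free_alg := c *: (1 : free_alg).

Definition qi (i : 'I_(m + n)) : k := if (i < m)%N then q else q^-1.

(* The scalar c with K E_j = c E_j K: q_i^(delta_ij - delta_(i,j+1)) for K_i, *)
(* and the quotient of those of K_i and K_(i+1) for calK_i.                   *)
Definition kfac (g : gtype) : cartan m n g -> J -> k :=
  let kf (i : 'I_(m + n)) (j : J) := qi i ^ ((i == lo j)%:Z - (i == hi j)%:Z) in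
  match g with GL => kf | SL => fun i j => kf (lo i) j / kf (hi i) j end.

(* calK_i = K_i K_(i+1)^-1 and its inverse *)
Definition calK : J -> free_alg :=
  match g return (gen m n g -> free_alg) -> J -> free_alg with
  | GL => fun X i => X (gK (lo i : cartan m n GL)) * X (gKinv (hi i : cartan m n GL))
  | SL => fun X i => X (gK (i : cartan m n SL))
  end fgen.

Definition calKinv : J -> free_alg :=
  match g return (gen m n g -> free_alg) -> J -> free_alg with
  | GL => fun X i => X (gK (hi i : cartan m n GL)) * X (gKinv (lo i : cartan m n GL))
  | SL => fun X i => X (gKinv (i : cartan m n SL))
  end fgen.

Notation E i := (fgen (gE i)).
Notation F i := (fgen (gF i)).
Notation K a := (fgen (gK a)).
Notation Kinv a := (fgen (gKinv a)).
Notation sigma := (fgen gSigma).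

Definition adjacent (i j : J) : bool := (i.+1 == j :> nat) || (j.+1 == i :> nat).
Definition far (i j : J) : bool := (i.+1 < j)%N || (j.+1 < i)%N.

Inductive Urel : free_alg -> free_alg -> Prop :=
| U_KK a b : Urel (K a * K b) (K b * K a)
| U_KKinv a : Urel (K a * Kinv a) 1
| U_KinvK a : Urel (Kinv a * K a) 1
| U_KE a j : Urel (K a * E j) (kfac a j *: (E j * K a))
| U_KF a j : Urel (K a * F j) ((kfac a j)^-1 *: (F j * K a))
| U_EF i j :
    Urel (E i * F j - (-1) ^+ (odd_node i * odd_node j) * (F j * E i))
         (if i == j then (qi (lo i) - (qi (lo i))^-1)^-1 *: (calK i - calKinv i)
          else 0)
| U_EE i j : far i j -> Urel (E i * E j) (E j * E i)
| U_FF i j : far i j -> Urel (F i * F j) (F j * F i)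
| U_SerreE i j : adjacent i j -> ~~ odd_node i ->
    Urel (E i ^+ 2 * E j - (q + q^-1) *: (E i * E j * E i) + E j * E i ^+ 2) 0
| U_SerreF i j : adjacent i j -> ~~ odd_node i ->
    Urel (F i ^+ 2 * F j - (q + q^-1) *: (F i * F j * F i) + F j * F i ^+ 2) 0
| U_E2 i : odd_node i -> Urel (E i ^+ 2) 0
| U_F2 i : odd_node i -> Urel (F i ^+ 2) 0
| U_Serre4E (h i j : J) :
    odd_node i -> i = h.+1 :> nat -> j = i.+1 :> nat ->
    Urel (E h * E i * E j * E i + E i * E h * E i * E j
          + E j * E i * E h * E i + E i * E j * E i * E h
          - (q + q^-1) *: (E i * E h * E j * E i)) 0
| U_Serre4F (h i j : J) :
    odd_node i -> i = h.+1 :> nat -> j = i.+1 :> nat ->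
    Urel (F h * F i * F j * F i + F i * F h * F i * F j
          + F j * F i * F h * F i + F i * F j * F i * F h
          - (q + q^-1) *: (F i * F h * F j * F i)) 0
| U_sigma2 : Urel (sigma ^+ 2) 1
| U_sigmaE j : Urel (sigma * E j * sigma) ((-1) ^+ odd_node j * E j)
| U_sigmaF j : Urel (sigma * F j * sigma) ((-1) ^+ odd_node j * F j)
| U_sigmaK a : Urel (sigma * K a * sigma) (K a).

(* The bosonization calU_q(gl(m|n)) or calU_q(sl(m|n)). *)
Definition Uq : Type := quot_ring Urel.
HB.instance Definition _ := GRing.PzRing.on Uq.

Definition piU (x : free_alg) : Uq := quot_pi Urel x.

Inductive urel (l : nat) : Uq -> Uq -> Prop :=
| u_El i : ~~ odd_node i -> urel l (piU (E i) ^+ l) 0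
| u_Fl i : ~~ odd_node i -> urel l (piU (F i) ^+ l) 0
| u_E2 i : odd_node i -> urel l (piU (E i) ^+ 2) 0
| u_F2 i : odd_node i -> urel l (piU (F i) ^+ 2) 0
| u_K2l a : urel l (piU (K a) ^+ (2 * l)) 1.

Definition uq (l : nat) : Type := quot_ring (@urel l).
HB.instance Definition _ l := GRing.PzRing.on (uq l).

Definition piu (l : nat) (x : free_alg) : uq l := quot_pi (@urel l) (piU x).

(* Highest weight theory for modules over a quotient pi : free_alg -> U, used *)
(* with U = Uq and U = uq l.  Scalars of k act through pi.                    *)

Section HighestWeight.
Context (U : pzRingType) (pi : free_alg -> U).

Definition hw_vector (lam : weight m n) (M : lmodType U) (v : M) : Prop :=
  [/\ v != 0,
      forall j, pi (E j) *: v = 0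
    & forall a, pi (K a) *: v = pi (fscal (q ^ wform lam (cartan_wt a))) *: v].

Definition simple_hw (lam : weight m n) (M : lmodType U) (S : {pred M}) (v : M) :=
  [/\ hw_vector lam v, generated_by S v & simple_submod S].

(* S is isomorphic to V(lam), a simple module generated by a highest weight   *)
(* vector of weight lam. *)
Definition iso_V (lam : weight m n) (M : lmodType U) (S : {pred M}) : Prop :=
  exists (V : lmodType U) (w : V) (f : {linear V -> M}),
    [/\ simple_hw lam predT w, injective f
      & forall u, u \in S <-> exists x, u = f x].

End HighestWeight.

End QuantumSuperalgebra.

Section Grassmann.
Context (k : fieldType) (q : k) (m n : nat).

(* (alpha, mu) is the index of the basis element x^(alpha) (x) x^mu. *)
Definition mono := ({ffun 'I_m -> nat} * {ffun 'I_n -> bool})%type.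

Definition Omega := {malg k[mono]}.

HB.instance Definition _ := GRing.Lmodule.on Omega.

Definition x_mono (b : mono) : Omega := << b >>.

Definition linext (f : mono -> Omega) (u : Omega) : Omega :=
  \sum_(b <- msupp u) u@_b *: f b.

(* alpha and mu viewed in Z^(m+n), supported on I_0 and I_1 respectively. *)
Definition wt0 (b : mono) : weight m n :=
  [ffun i => if split i is inl i0 then (b.1 i0)%:Z else 0].
Definition wt1 (b : mono) : weight m n :=
  [ffun i => if split i is inr i1 then (b.2 i1)%:Z else 0].

Definition mono_mul (a b : mono) : Omega :=
  if [exists i, a.2 i && b.2 i] then 0 else
  (q ^ star (wt1 a) (wt0 b)
   * (q ^ star (wt0 a) (wt0 b) * \prod_i qbin q (a.1 i + b.1 i) (a.1 i))
   * (- q) ^ star (wt1 a) (wt1 b))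
  *: x_mono ([ffun i => (a.1 i + b.1 i)%N], [ffun i => a.2 i || b.2 i]).

Definition omul (u v : Omega) : Omega :=
  linext (fun a => linext (mono_mul a) v) u.

Definition mono_eps (i : 'I_(m + n)) : mono :=
  match split i with
  | inl i0 => ([ffun j => nat_of_bool (j == i0)], [ffun=> false])
  | inr i1 => ([ffun=> 0%N], [ffun j => j == i1])
  end.

Definition x_ (i : 'I_(m + n)) : Omega -> Omega := omul (x_mono (mono_eps i)).

Definition diag_op (c : mono -> k) : Omega -> Omega :=
  linext (fun b => c b *: x_mono b).

(* Eigenvalue of sigma_i. *)
Definition sigma_val (i : 'I_(m + n)) (b : mono) : k :=
  match split i with
  | inl i0 => q ^+ b.1 i0
  | inr i1 => (- q) ^+ b.2 i1
  end.

(* Eigenvalue of sigma_i for i in I_0, of (sigma_i tau_i)^-1 for i in I_1. *)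
Definition K_val (i : 'I_(m + n)) (b : mono) : k :=
  match split i with
  | inl i0 => sigma_val i b
  | inr i1 => (sigma_val i b * (-1) ^+ b.2 i1)^-1
  end.

Definition sigma_op (i : 'I_(m + n)) := diag_op (sigma_val i).
Definition sigmaV_op (i : 'I_(m + n)) := diag_op (fun b => (sigma_val i b)^-1).

Definition partial_ (i : 'I_(m + n)) : Omega -> Omega :=
  linext (fun b =>
    match split i with
    | inl i0 =>
        if b.1 i0 == 0%N then 0 else
        q ^ (- star (eps i) (wt0 b))
        *: x_mono ([ffun j => (b.1 j - (j == i0))%N], b.2)
    | inr i1 =>
        if b.2 i1 then
          (q ^ (- star (eps i) (wt0 b)) * (- q) ^ (- star (eps i) (wt1 b)))
          *: x_mono (b.1, [ffun j => b.2 j && (j != i1)])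
        else 0
    end).

Definition E_op (j : 'I_(m + n).-1) (u : Omega) : Omega :=
  x_ (lo j) (partial_ (hi j) (sigma_op (lo j) u)).

Definition F_op (j : 'I_(m + n).-1) (u : Omega) : Omega :=
  sigmaV_op (lo j) (x_ (hi j) (partial_ (lo j) u)).

Definition K_op (g : gtype) : cartan m n g -> Omega -> Omega :=
  match g with
  | GL => fun i => diag_op (K_val i)
  | SL => fun j => diag_op (fun b => K_val (lo j) b / K_val (hi j) b)
  end.

Definition parity_op : Omega -> Omega :=
  diag_op (fun b => (-1) ^+ (\sum_i b.2 i)%N).

(* For U = Uq or uq l with pi : free_alg -> U, and W = Omega or a subspace of *)
(* Omega with inclusion iota: the U-module structure rho on W extends the     *)
(* k-space structure and the generators act by the prescribed operators; the  *)
(* action of the inverses of the Cartan generators is then determined.        *)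
Definition acts_by (g : gtype) (U : pzRingType) (pi : free_alg k m n g -> U)
    (W : lmodType k) (iota : W -> Omega) (rho : module_on U W) : Prop :=
  [/\ forall c v, rho (pi (fscal m n g c)) v = c *: v,
      forall j v, iota (rho (pi (fgen k (gE j))) v) = E_op j (iota v),
      forall j v, iota (rho (pi (fgen k (gF j))) v) = F_op j (iota v),
      forall a v, iota (rho (pi (fgen k (gK a))) v) = K_op a (iota v)
    & forall v, iota (rho (pi (fgen k gSigma)) v) = parity_op (iota v)].

Definition mono_deg (b : mono) : nat := (\sum_i b.1 i + \sum_i b.2 i)%N.

Definition homog (t : nat) : {pred Omega} :=
  [pred u : Omega | all (fun b => mono_deg b == t) (msupp u)].

Definition restricted (l : nat) : {pred Omega} :=
  [pred u : Omega | all (fun b : mono => [forall i, b.1 i <= l.-1]%N) (msupp u)].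

Fact restricted_submod l : submod_closed (restricted l).
Proof.
have inP (u : Omega) : reflect (forall b, u@_b != 0 -> [forall i, b.1 i <= l.-1]%N)
                     (u \in restricted l).
  apply: (iffP allP) => H b; first by rewrite mcoeff_neq0; apply: H.
  by rewrite -mcoeff_neq0; apply: H.
split=> [|c u v /inP Hu /inP Hv].
  by apply/inP => b; rewrite mcoeff0 eqxx.
apply/inP => b; rewrite mcoeffD mcoeffZ.
have [u0|/Hu //] := eqVneq u@_b 0.
by rewrite u0 mulr0 add0r; apply: Hv.
Qed.

HB.instance Definition _ l :=
  GRing.isSubmodClosed.Build k Omega (restricted l) (restricted_submod l).

(* Omega_q(m|n, 1) *)
Record Omega1 (l : nat) : Type := MkOmega1 {
  Omega1_val : Omega;
  _ : Omega1_val \in restricted l }.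

HB.instance Definition _ l := [isSub for @Omega1_val l].
HB.instance Definition _ l := [Choice of Omega1 l by <:].
HB.instance Definition _ l := [SubChoice_isSubLmodule of Omega1 l by <:].

Definition homog1 (l t : nat) : {pred Omega1 l} :=
  [pred u : Omega1 l | val u \in homog t].

(* The basis elements x^(a) (x) x_(m+1)...x_(m+p), for a : nat -> nat giving  *)
(* the exponents (indexed from 0). *)
Definition x_vec (a : nat -> nat) (p : nat) : Omega :=
  x_mono ([ffun i : 'I_m => a i], [ffun i : 'I_n => (i < p)%N]).

End Grassmann.

Arguments homog k m n t : clear implicits.
Arguments homog1 k m n l t : clear implicits.
Arguments x_vec k m n a p : clear implicits.
Arguments Omega1 k m n l : clear implicits.
Arguments Uq {k} q m n g.
Arguments uq {k} q m n g l.
Arguments piU {k} q {m n g} x.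
Arguments piu {k} q {m n g} l x.

(* Main.v *)
Require Import Defs.
From HB Require Import structures.
From mathcomp Require Import all_boot all_order all_algebra.
From mathcomp Require Import finmap zify ring.
From mathcomp.classical Require Import boolp.
From mathcomp.multinomials Require Import monalg.
Import GRing.Theory.
Local Open Scope ring_scope.

Set Implicit Arguments.
Unset Strict Implicit.
Unset Printing Implicit Defensive.

(** Why the theorem is true.

    The powers of q carried by x_i, by its derivation and by sigma_i cancel in
    E_j = x_j d_(j+1) sigma_j and F_j = sigma_j^-1 x_(j+1) d_j (E_opE, F_opE).
    What remains is an action on an ordinary tensor product with one factor,
    called a site, for each i in I: divided powers of one variable if i is in
    I_0, the span of 1 and x_i if i is in I_1.  At an even site put
    R_i x^(c) = [c+1] x^(c+1), at an odd site let R_i multiply by x_i, and let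
    L_i remove one unit of exponent; then E_j = R_j L_(j+1) and
    F_j = R_(j+1) L_j.

    The relations.  Operators at distinct sites commute, so each defining
    relation of the quantum superalgebra collapses to an identity at single
    sites: [c+2] + [c] = [2][c+1] for the Serre relations, R^2 = L^2 = 0 at the
    odd sites, and [a][c+1] - [a+1][c] = [a-c] for the commutator of E_j and
    F_j.  The relations among the F_j are those among the E_j with R and L
    exchanged, hence are proved once (the ladder lemmas).  So the free algebra
    acts through the quotient U_q (Urel_act); on the restricted part l moves
    into an even site overflow it and q^(2l) = 1, so the action factors
    through u_q (urel_Omega1).

    The submodules.  E_j sends distinct monomials to multiples of distinct
    monomials, so a vector is killed by all E_j only if each of its monomials
    is (E_op_kernel).  A monomial is killed exactly when every site in front of
    a nonempty site is full, which means exponent l - 1 at an even site (never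
    when q is not a root of unity) and exponent 1 at an odd site.  Such a
    staircase is determined by its total (staircase_unique), so every degree
    has a single killed monomial x_top, the announced highest weight vector.
    Each E_j lowers the height, the sum of i times the exponent at i; raising a
    nonzero vector of a submodule as long as possible therefore ends at a
    multiple of x_top.  Conversely, if E_j moves a monomial b to b', then F_j
    moves b' back to a nonzero multiple of b, so x_top generates everything of
    its degree.  Weights are never compared: for sl and m = n distinct
    monomials of the same degree can have the same weight.  *)

(** * Linear extension from a basis *)

Lemma malgUZ (k : fieldType) (K : choiceType) (c : k) (b : K) :
  << c *g b >> = c *: << b >> :> {malg k[K]}.
Proof. by apply/malgP => d; rewrite mcoeffZ !mcoeffU mulrnAr mulr1. Qed.

Lemma scaler_congr (k : fieldType) (V : lmodType k) (x : V) (a b : k) :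
  a = b -> a *: x = b *: x.
Proof. by move->. Qed.

Lemma scale_comb (k : fieldType) (V : lmodType k) (x : V) (s e c1 c2 d1 d2 : k) :
  c1 - s * c2 = e * (d1 - d2) ->
  c1 *: x - s *: (c2 *: x) = e *: (d1 *: x - d2 *: x).
Proof. by move=> cd; rewrite -scalerBl !scalerA -scalerBl cd. Qed.

Lemma scale3_eq0 (k : fieldType) (V : lmodType k) (x y z : V) (a b c : k) :
    a - b + c = 0 -> a = 0 \/ x = y -> c = 0 \/ z = y ->
  a *: x - b *: y + c *: z = 0.
Proof.
move=> abc xy zy.
have -> : a *: x = a *: y by case: xy => ->; rewrite ?scale0r.
have -> : c *: z = c *: y by case: zy => ->; rewrite ?scale0r.
by rewrite -scalerBl -scalerDl abc scale0r.
Qed.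

Section LinearExtension.
Context (k : fieldType) (K : choiceType) (V : lmodType k).

Definition basis_ext (f : K -> V) (u : {malg k[K]}) : V :=
  \sum_(b <- msupp u) u@_b *: f b.

Lemma basis_extw f (d : {fset K}) (u : {malg k[K]}) :
  (msupp u `<=` d)%fset -> basis_ext f u = \sum_(b <- d) u@_b *: f b.
Proof.
move=> sub_d; rewrite /basis_ext (big_fset_incl _ sub_d) //= => b _ Nb.
by rewrite mcoeff_outdom // scale0r.
Qed.

Lemma basis_ext_linear f : linear (basis_ext f).
Proof.
move=> c u v; pose d := (msupp u `|` msupp v)%fset.
have Du : (msupp u `<=` d)%fset by apply: fsubsetUl.
have Dv : (msupp v `<=` d)%fset by apply: fsubsetUr.
have Dw : (msupp (c *: u + v) `<=` d)%fset.
  apply: fsubset_trans (msuppD_le _ _) _; rewrite fsubUset Dv andbT.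
  exact: fsubset_trans (msuppZ_le _ _) Du.
rewrite (basis_extw f Du) (basis_extw f Dv) (basis_extw f Dw) scaler_sumr.
rewrite -big_split /=; apply: eq_bigr => b _.
by rewrite mcoeffD mcoeffZ scalerDl scalerA.
Qed.

HB.instance Definition _ f :=
  GRing.isLinear.Build k {malg k[K]} V *:%R (basis_ext f) (basis_ext_linear f).

Lemma basis_extU f b : basis_ext f << b >> = f b.
Proof. by rewrite /basis_ext msuppU oner_eq0 big_seq_fset1 mcoeffUU scale1r. Qed.

Lemma malg_linear_eq (f g : {linear {malg k[K]} -> V}) :
  (forall b, f << b >> = g << b >>) -> f =1 g.
Proof.
move=> fg u; rewrite [u]monalgE !linear_sum; apply: eq_bigr => b _ /=.
by rewrite malgUZ !linearZ /= fg.
Qed.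

End LinearExtension.

(** * Actions of a free algebra and of its quotients *)

Section FreeAction.
Context (k : fieldType) (q : k) (m n : nat) (g : gtype) (V : lmodType k).
Context (op : gen m n g -> {linear V -> V}).

Notation A := (free_alg k m n g).

Definition word_act (w : {fmonom (gen m n g)}) (v : V) : V :=
  foldr (fun x => op x) v (w : seq _).

Lemma word_act_linear w : linear (word_act w).
Proof.
rewrite /word_act => c u v; elim: (w : seq _) => //= x s ->.
by rewrite linearP.
Qed.

HB.instance Definition _ w :=
  GRing.isLinear.Build k V V *:%R (word_act w) (word_act_linear w).

Definition free_act (x : A) (v : V) : V := basis_ext (word_act^~ v) x.

Lemma free_act_linearr x : linear (free_act x).
Proof.
move=> c u v; rewrite /free_act /basis_ext scaler_sumr -big_split /=.
apply: eq_bigr => w _.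
by rewrite word_act_linear scalerDr !scalerA mulrC.
Qed.

HB.instance Definition _ x :=
  GRing.isLinear.Build k V V *:%R (free_act x) (free_act_linearr x).

Lemma free_act_linearl v c x y :
  free_act (c *: x + y) v = c *: free_act x v + free_act y v.
Proof. exact: (basis_ext_linear (word_act^~ v)). Qed.

Lemma free_actU w v : free_act << w >> v = word_act w v.
Proof. exact: (basis_extU (word_act^~ v)). Qed.

Lemma free_actZU c w v : free_act << c *g w >> v = c *: word_act w v.
Proof. by rewrite malgUZ -free_actU /free_act linearZ. Qed.

Lemma free_act1 v : free_act 1 v = v.
Proof. by rewrite (free_actU (fmone _)) /word_act fmoneE. Qed.

Lemma free_actM x y v : free_act x (free_act y v) = free_act (x * y) v.
Proof.
have sumA (I : Type) (r : seq I) (F : I -> A) u :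
    free_act (\sum_(i <- r) F i) u = \sum_(i <- r) free_act (F i) u.
  exact: (linear_sum (basis_ext (word_act^~ u))).
transitivity (\sum_(w <- msupp x) x@_w *: word_act w (free_act y v)) => //.
rewrite malgME sumA; apply: eq_bigr => w1 _.
rewrite sumA linear_sum scaler_sumr; apply: eq_bigr => w2 _ /=.
rewrite linearZ /= scalerA; apply/esym.
by rewrite [LHS]free_actZU /word_act fmM foldr_cat.
Qed.

Definition free_module : module_on A V.
Proof.
refine (@ModuleOn A V free_act _ free_act1 _ _).
- by move=> x y v; rewrite free_actM.
- by move=> x u v; rewrite linearD.
- by move=> v x y; have := free_act_linearl v 1 x y; rewrite !scale1r.
Defined.

Lemma free_moduleZ c x v : free_module (c *: x) v = c *: free_module x v.
Proof.
by have := free_act_linearl v c x 0; rewrite !addr0 /= /free_act linear0 addr0.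
Qed.

Lemma free_module_gen x v : free_module (fgen k x) v = op x v.
Proof. by rewrite /= free_actU /word_act fmU. Qed.

Lemma free_module_scal c v : free_module (fscal m n g c) v = c *: v.
Proof. by rewrite free_moduleZ /= free_act1. Qed.

(** Every element of the free algebra is a combination of words, so a property
    closed under combinations only has to be checked for the generators. *)
Lemma free_module_stable (T : {pred V}) :
  submod_closed T -> (forall x v, v \in T -> op x v \in T) ->
  forall x v, v \in T -> free_module x v \in T.
Proof.
move=> [T0 TD] Tgen x v Tv; rewrite /= /free_act /basis_ext.
elim: (X in \sum_(_ <- X) _) => [|w r IHr]; first by rewrite big_nil.
rewrite big_cons; apply: TD => //.
by rewrite /word_act; elim: (w : seq _) => //= y s; apply: Tgen.
Qed.

End FreeAction.

(** This transports relations: an identity that holds for the operators on W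
    holds on V as soon as f is injective. *)
Lemma free_module_intertwine (k : fieldType) (m n : nat) (g : gtype)
    (V W : lmodType k) (opV : gen m n g -> {linear V -> V})
    (opW : gen m n g -> {linear W -> W}) (f : {linear V -> W}) :
    (forall x v, f (opV x v) = opW x (f v)) ->
  forall x v, f (free_module opV x v) = free_module opW x (f v).
Proof.
move=> fop x v; rewrite /= /free_act /basis_ext linear_sum; apply: eq_bigr => w _.
rewrite linearZ /=; congr (_ *: _); rewrite /word_act.
by elim: (w : seq _) => //= y s <-.
Qed.

Section ModuleOnTheory.
Context (A : pzRingType) (V : zmodType) (rho : module_on A V).

Lemma module0l v : rho 0 v = 0.
Proof. by apply: (addrI (rho 0 v)); rewrite -actDl !addr0. Qed.

Lemma module0r x : rho x 0 = 0.
Proof. by apply: (addrI (rho x 0)); rewrite -actDr !addr0. Qed.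

Lemma moduleNl x v : rho (- x) v = - rho x v.
Proof. by apply: (addrI (rho x v)); rewrite -actDl !subrr module0l. Qed.

Lemma moduleBl x y v : rho (x - y) v = rho x v - rho y v.
Proof. by rewrite actDl moduleNl. Qed.

End ModuleOnTheory.

Section QuotientAction.
Context (A : pzRingType) (R : A -> A -> Prop) (V : zmodType).
Context (rho : module_on A V).
Context (rhoR : forall x y, R x y -> forall v, rho x v = rho y v).

(** An element of the ideal is a sum of terms a (x - y) b with x and y related,
    and each of them acts by zero. *)
Lemma module_ideal z : ideal_gen R z -> forall v, rho z v = 0.
Proof.
elim=> [|a b x y z' Rxy _ IH] v; first exact: module0l.
by rewrite actDl IH addr0 -!actA moduleBl (rhoR Rxy) subrr module0r.
Qed.

Lemma quot_pi_repr (u : quot_ring R) : quot_pi R (repr u) = u.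
Proof. by rewrite /quot_pi reprK. Qed.

Lemma module_quot_pi x y : quot_pi R x = quot_pi R y ->
  forall v, rho x v = rho y v.
Proof.
move=> /eqP/quot_eqP/module_ideal xy v.
by apply/eqP; rewrite -subr_eq0 -moduleBl xy.
Qed.

Definition quot_act (u : quot_ring R) (v : V) : V := rho (repr u) v.

Lemma quot_actE x v : quot_act (quot_pi R x) v = rho x v.
Proof. by apply: module_quot_pi; rewrite quot_pi_repr. Qed.

Definition quot_module : module_on (quot_ring R) V.
Proof.
refine (@ModuleOn _ V quot_act _ _ _ _).
- move=> a b v; rewrite -[a]quot_pi_repr -[b]quot_pi_repr -quot_piM.
  by rewrite !quot_actE actA.
- by move=> v; rewrite -quot_pi1 quot_actE act1.
- by move=> a u v; rewrite /quot_act actDr.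
- move=> v a b; rewrite -[a]quot_pi_repr -[b]quot_pi_repr -quot_piD.
  by rewrite !quot_actE actDl.
Defined.

Lemma quot_moduleE x v : quot_module (quot_pi R x) v = rho x v.
Proof. exact: quot_actE. Qed.

End QuotientAction.

(** * The module carried by a simple submodule *)

Section SubModule.
Context (U : pzRingType) (M : lmodType U) (S : {pred M}).
Context (S_closed : submod_closed S).

Definition sub_pred of submod_closed S : {pred M} := S.
HB.instance Definition _ :=
  GRing.isSubmodClosed.Build U M (sub_pred S_closed) S_closed.

Record sub_module := SubModule {
  sub_module_val : M; _ : sub_module_val \in sub_pred S_closed }.
HB.instance Definition _ := [isSub for sub_module_val].
HB.instance Definition _ := [Choice of sub_module by <:].
HB.instance Definition _ := [SubChoice_isSubLmodule of sub_module by <:].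

End SubModule.

(** V(lam) is realized by the submodule itself, with its inclusion. *)
Lemma simple_hw_iso_V (k : fieldType) (q : k) (m n : nat) (g : gtype)
    (U : pzRingType) (pi : free_alg k m n g -> U) (lam : weight m n)
    (M : lmodType U) (S : {pred M}) (v : M) :
  simple_hw q pi lam S v -> iso_V q pi lam S.
Proof.
move=> [[v0 Ev Kv] genS [clS nzS simS]].
have Sv : v \in S by apply/genS; exists 1; rewrite scale1r.
pose V : lmodType U := sub_module clS; pose w : V := SubModule Sv.
exists V, w, (\val : {linear V -> M}); split; first last.
- move=> u; split=> [Su | [x ->]]; last exact: valP x.
  by exists (SubModule (Su : u \in sub_pred clS)).
- exact: val_inj.
split.
- split; first by apply: contra_neq v0 => /(congr1 val).
    by move=> j; apply: val_inj; rewrite linearZ /= Ev.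
  by move=> a; apply: val_inj; rewrite !linearZ /= Kv.
- move=> u; split=> // _; have /genS[a ua] := valP u.
  by exists a; apply: val_inj; rewrite linearZ.
split=> //; first by exists w => //; apply: contra_neq v0 => /(congr1 val).
move=> T [T0 TD] _.
(* A submodule of the subtype, seen inside M. *)
pose T' : {pred M} := fun x => oapp (mem T) false (insub x : option V).
have T'val x : (val x \in T') = (x \in T) by rewrite unfold_in /T' valK.
have T'S : {subset T' <= S}.
  by move=> x; rewrite unfold_in /T'; case: insubP => // y Sx _.
have inT' x : x \in T' -> exists2 y, val y = x & y \in T.
  by rewrite unfold_in /T'; case: insubP => // y _ <-; exists y.
have clT' : submod_closed T'.
  split=> [|a _ _ /inT'[x <- Tx] /inT'[y <- Ty]].
    by rewrite -[0](linear0 (\val : {linear V -> M})) T'val.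
  by rewrite -linearP T'val; apply: TD.
case: (simS _ clT' T'S) => eqT; [left | right] => x; rewrite -T'val eqT.
  by rewrite !inE -(inj_eq val_inj) linear0.
by rewrite (valP x).
Qed.

(** * Exponents of monomials *)

(** At an odd site only whether c vanishes is recorded, so that every c yields a
    monomial; trunc below is the exponent that is actually stored. *)
HB.lock Definition upd (m n : nat) (b : mono m n) (i : 'I_(m + n)) (c : nat) :
    mono m n :=
  match split i with
  | inl i0 => ([ffun j => if j == i0 then c else b.1 j], b.2)
  | inr i1 => (b.1, [ffun j => if j == i1 then (0 < c)%N else b.2 j])
  end.

Section Exponents.
Context (m n : nat).
Notation I := 'I_(m + n).
Implicit Types (b : mono m n) (i j : I) (c : nat).

Lemma lo_neq_hi (j : 'I_(m + n).-1) : lo j != hi j.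
Proof. by rewrite -val_eqE /= neq_ltn ltnSn. Qed.

Definition expo b i : nat :=
  match split i with inl i0 => b.1 i0 | inr i1 => b.2 i1 end.

Definition trunc i c : nat := if (i < m)%N then c else (0 < c)%N.

Lemma split_lshift (i : 'I_m) : split (lshift n i) = inl i.
Proof. exact: (unsplitK (inl i)). Qed.

Lemma split_rshift (i : 'I_n) : split (rshift m i) = inr i.
Proof. exact: (unsplitK (inr i)). Qed.

Lemma expo_upd b i c j :
  expo (upd b i c) j = if j == i then trunc i c else expo b j.
Proof.
rewrite /expo upd.unlock /trunc.
case: (split_ordP i) => i0 ->; case: (split_ordP j) => j0 ->;
  rewrite ?eq_lshift ?eq_rshift ?eq_lrshift ?eq_rlshift ?ffunE //=.
by case: eqP.
Qed.

Lemma trunc_expo b i : trunc i (expo b i) = expo b i.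
Proof. by rewrite /expo /trunc; case: split_ordP => i0 _ //; case: (b.2 i0). Qed.

Lemma mono_ext b b' : expo b =1 expo b' -> b = b'.
Proof.
case: b b' => [a u] [a' u'] eqb; congr (_, _); apply/ffunP => i.
  by have := eqb (lshift n i); rewrite /expo split_lshift.
have := eqb (rshift m i); rewrite /expo split_rshift /=.
by case: (u i); case: (u' i).
Qed.

Lemma mono_degE b : mono_deg b = (\sum_i expo b i)%N.
Proof.
rewrite big_split_ord /=; congr (_ + _)%N; apply: eq_bigr => i _.
  by rewrite /expo split_lshift.
by rewrite /expo split_rshift.
Qed.

Lemma wt0E b i : wt0 b i = if (i < m)%N then (expo b i)%:Z else 0.
Proof. by rewrite ffunE /expo; case: split_ordP. Qed.

Lemma wt1E b i : wt1 b i = if (i < m)%N then 0 else (expo b i)%:Z.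
Proof. by rewrite ffunE /expo; case: split_ordP. Qed.

Lemma star_eps i (w : weight m n) :
  star (eps i) w = \sum_(j < m + n | (j < i)%N) w j.
Proof.
rewrite /star (bigD1 i) //= [X in _ + X]big1 ?addr0 => [|l l_i].
  by apply: eq_bigr => j _; rewrite ffunE eqxx mul1r.
by apply: big1 => j _; rewrite ffunE (negPf l_i) mul0r.
Qed.

Lemma star0l (w : weight m n) : star 0 w = 0.
Proof. by apply: big1 => i _; apply: big1 => j _; rewrite ffunE mul0r. Qed.

(** Passing to the next site adds one term to the exponent of q; this is the
    source of the cancellation in E_j and F_j. *)
Lemma star_eps_hi (j : 'I_(m + n).-1) (w : weight m n) :
  star (eps (hi j)) w = star (eps (lo j)) w + w (lo j).
Proof.
rewrite !star_eps (bigD1 (lo j)) //= addrC; congr (_ + _).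
by apply: eq_bigl => i; rewrite ltnS -val_eqE /=; lia.
Qed.

Lemma star_eps_eq i (w w' : weight m n) :
  (forall j, (j < i)%N -> w j = w' j) -> star (eps i) w = star (eps i) w'.
Proof. by move=> eq_w; rewrite !star_eps; apply: eq_bigr. Qed.

End Exponents.

(** * Quantum integers *)

Section QuantumNumbers.
Context (k : fieldType) (q : k) (q_neq0 : q != 0) (q2_neq1 : q ^+ 2 != 1).

Lemma q_subV_neq0 : q - q^-1 != 0.
Proof.
apply: contra_neq q2_neq1 => /eqP; rewrite subr_eq0 => /eqP qV.
by rewrite expr2 {2}qV divff.
Qed.

Lemma qnum0 : qnum q 0 = 0.
Proof. by rewrite /qnum expr0 invr1 subrr mul0r. Qed.

Lemma qnum1 : qnum q 1 = 1.
Proof. by rewrite /qnum expr1 divff // q_subV_neq0. Qed.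

(** The three-term recursion behind all Serre relations. *)
Lemma qnumSS c : qnum q c.+2 = (q + q^-1) * qnum q c.+1 - qnum q c.
Proof.
have x0 : q ^+ c != 0 by rewrite expf_neq0.
rewrite /qnum !exprS; field.
by rewrite q_neq0 subr_eq0 -expr2 q2_neq1 x0.
Qed.

(** [a][c+1] - [a+1][c] = [a-c], with the denominator cleared because a - c may
    be negative. *)
Lemma qnumB a c : (q - q^-1) * (qnum q a * qnum q c.+1 - qnum q a.+1 * qnum q c)
  = q ^+ a * q ^- c - q ^- a * q ^+ c.
Proof.
have x0 : q ^+ c != 0 by rewrite expf_neq0.
have y0 : q ^+ a != 0 by rewrite expf_neq0.
rewrite /qnum !exprS; field.
by rewrite q_neq0 subr_eq0 -expr2 q2_neq1 x0 y0.
Qed.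

Lemma qbin0 s : qbin q s 0 = 1.
Proof.
rewrite /qbin /qbin_num /qbin_den !big_geq // divpp ?oner_eq0 //.
by rewrite hornerC mul0n invr1 mul1r.
Qed.

(** Here the polynomial quotient is the geometric sum of the powers of X^2. *)
Lemma qbin1 s : qbin q s.+1 1 = qnum q s.+1.
Proof.
rewrite /qbin /qbin_num /qbin_den !big_nat1 subn1 mul1n muln1 addn1 /=.
have Xs : 'X^(2 * s.+1) - 1 = ('X^2 - 1) * \sum_(i < s.+1) 'X^(2 * i) :> {poly k}.
  rewrite exprM subrX1; congr (_ * _); apply: eq_bigr => i _.
  by rewrite exprM.
have X2 : 'X^2 - 1 != 0 :> {poly k} by rewrite -size_poly_eq0 size_XnsubC.
rewrite Xs mulKp //.
have : (('X^2 - 1) * \sum_(i < s.+1) 'X^(2 * i)).[q] = q ^+ (2 * s.+1) - 1.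
  by rewrite -Xs !hornerE.
rewrite hornerM !hornerE => /(canRL (mulKf _)) ->; last by rewrite subr_eq0.
have x0 : q ^+ s != 0 by rewrite expf_neq0.
rewrite /qnum mulnC exprM !exprS; field.
by rewrite q_neq0 subr_eq0 -expr2 q2_neq1 x0.
Qed.

End QuantumNumbers.

(** * Operators on one tensor factor *)

(** The operator x^(c) |-> f(c) x^(s(c)) on the factor i, and the identity on
    the others. *)
HB.lock Definition site (k : fieldType) (m n : nat) (i : 'I_(m + n))
    (f : nat -> k) (s : nat -> nat) : Omega k m n -> Omega k m n :=
  basis_ext (fun b => f (expo b i) *: x_mono k (upd b i (s (expo b i)))).

Section Sites.
Context (k : fieldType) (m n : nat).
Notation I := 'I_(m + n).
Notation Om := (Omega k m n).
Implicit Types (b : mono m n) (i j : I) (c : nat) (v : Om).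

Lemma site_linear i f s : linear (@site k m n i f s).
Proof. by move=> c u v; rewrite site.unlock linearP. Qed.

HB.instance Definition _ i f s :=
  GRing.isLinear.Build k Om Om *:%R (site i f s) (site_linear i f s).

Lemma siteU i f s b :
  site i f s (x_mono k b) = f (expo b i) *: x_mono k (upd b i (s (expo b i))).
Proof. by rewrite site.unlock; apply: basis_extU. Qed.

Lemma Omega_linear_eq (f g : {linear Om -> Om}) :
  (forall b, f (x_mono k b) = g (x_mono k b)) -> f =1 g.
Proof. exact: malg_linear_eq. Qed.

Lemma site_comm i j f g s t v : i != j ->
  site i f s (site j g t v) = site j g t (site i f s v).
Proof.
move=> ij.
apply: (@Omega_linear_eq (site i f s \o site j g t) (site j g t \o site i f s)).
move=> b /=; rewrite !siteU !linearZ /= !siteU !scalerA mulrC.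
rewrite !expo_upd (negPf ij) eq_sym (negPf ij); congr (_ *: x_mono k _).
apply: mono_ext => l; rewrite !expo_upd.
by case: (eqVneq l i) => [->|//]; rewrite (negPf ij).
Qed.

Lemma upd_upd b i c d : upd (upd b i c) i d = upd b i d.
Proof.
by apply: mono_ext => l; rewrite !expo_upd; case: (eqVneq l i).
Qed.

Lemma site_comp i f g s t b :
  site i f s (site i g t (x_mono k b)) =
  (g (expo b i) * f (trunc i (t (expo b i))))
    *: x_mono k (upd b i (s (trunc i (t (expo b i))))).
Proof.
by rewrite !siteU linearZ /= siteU scalerA expo_upd eqxx upd_upd.
Qed.

Lemma site_comp3 i f g h s t u b :
  let c := expo b i in
  let d := trunc i (u c) in
  let e := trunc i (t d) in
  site i f s (site i g t (site i h u (x_mono k b))) =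
  (h c * g d * f e) *: x_mono k (upd b i (s e)).
Proof.
rewrite /= siteU !linearZ /= site_comp scalerA expo_upd eqxx upd_upd.
by rewrite mulrA.
Qed.

End Sites.

Section Oscillators.
Context (k : fieldType) (q : k) (q_neq0 : q != 0) (q2_neq1 : q ^+ 2 != 1).
Context (m n : nat).
Notation I := 'I_(m + n).
Notation Om := (Omega k m n).
Implicit Types (b : mono m n) (i j : I) (c : nat) (v : Om).

(** At an odd site 0 is sent to 1 and 1 to 0, as x_i squares to zero. *)
Definition rise i c : k := if (i < m)%N then qnum q c.+1 else (c == 0%N)%:R.

Definition raise i : Om -> Om := site i (rise i) succn.
HB.instance Definition _ i :=
  GRing.Linear.copy (raise i) (site i (rise i) succn).

Definition lower i : Om -> Om := site i (fun c => (0 < c)%:R) predn.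
HB.instance Definition _ i :=
  GRing.Linear.copy (lower i) (site i (fun c => (0 < c)%:R) predn).

Lemma raise_comm i j v : raise i (raise j v) = raise j (raise i v).
Proof. by have [->|ij] := eqVneq i j; last exact: site_comm. Qed.

Lemma lower_comm i j v : lower i (lower j v) = lower j (lower i v).
Proof. by have [->|ij] := eqVneq i j; last exact: site_comm. Qed.

Lemma raise_lower_comm i j v : i != j ->
  raise i (lower j v) = lower j (raise i v).
Proof. exact: site_comm. Qed.

Lemma raise2_odd i v : (m <= i)%N -> raise i (raise i v) = 0.
Proof.
move=> mi; have im : (i < m)%N = false by rewrite ltnNge mi.
apply: (@Omega_linear_eq _ _ _ (raise i \o raise i) \0) => b /=.
by rewrite /raise site_comp /rise /trunc im /= mulr0 scale0r.
Qed.

Lemma lower2_odd i v : (m <= i)%N -> lower i (lower i v) = 0.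
Proof.
move=> mi; have im : (i < m)%N = false by rewrite ltnNge mi.
apply: (@Omega_linear_eq _ _ _ (lower i \o lower i) \0) => b /=.
rewrite /lower site_comp /trunc -trunc_expo /trunc im /=.
by case: (expo b i) => [|c]; rewrite ?mul0r ?mulr0 scale0r.
Qed.

(** On x^(c) the three terms have coefficients [c+1], [2][c] and [c-1]. *)
Lemma Serre_lower i v : (i < m)%N ->
  lower i (lower i (raise i v)) - (q + q^-1) *: lower i (raise i (lower i v))
    + raise i (lower i (lower i v)) = 0.
Proof.
move=> im.
pose F : {linear Om -> Om} :=
  (lower i \o (lower i \o raise i))
    \- ((q + q^-1) \*: (lower i \o (raise i \o lower i)))
    \+ (raise i \o (lower i \o lower i)).
suff F0 b : F (x_mono k b) = 0 by exact: (@Omega_linear_eq _ _ _ F \0).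
rewrite /F /= /raise /lower !site_comp3 scalerA /rise /trunc im.
case: (expo b i) => [|[|c]] /=; apply: scale3_eq0; rewrite ?qnumSS ?qnum0 //;
  by [ring | left; ring | right].
Qed.

(** On x^(c) the three terms have coefficients [c][c+1], [2][c+1][c+1] and
    [c+1][c+2]. *)
Lemma Serre_raise i v : (i < m)%N ->
  raise i (raise i (lower i v)) - (q + q^-1) *: raise i (lower i (raise i v))
    + lower i (raise i (raise i v)) = 0.
Proof.
move=> im.
pose F : {linear Om -> Om} :=
  (raise i \o (raise i \o lower i))
    \- ((q + q^-1) \*: (raise i \o (lower i \o raise i)))
    \+ (lower i \o (raise i \o raise i)).
suff F0 b : F (x_mono k b) = 0 by exact: (@Omega_linear_eq _ _ _ F \0).
rewrite /F /= /raise /lower !site_comp3 scalerA /rise /trunc im.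
case: (expo b i) => [|c] /=; apply: scale3_eq0;
  rewrite ?(qnumSS q_neq0 q2_neq1 c.+1) ?qnumSS ?qnum0 ?qnum1 //;
  by [ring | left; ring | right].
Qed.

Lemma raiseU i b : raise i (x_mono k b) =
  rise i (expo b i) *: x_mono k (upd b i (expo b i).+1).
Proof. exact: siteU. Qed.

Lemma lowerU i b : lower i (x_mono k b) =
  (0 < expo b i)%:R *: x_mono k (upd b i (expo b i).-1).
Proof. exact: siteU. Qed.

(** The factor by which x_i, and inversely its derivation, differ from the
    raising and lowering operators of the untwisted tensor product. *)
Definition twist i b : k := q ^ star (eps i) (wt0 b) * (- q) ^ star (eps i) (wt1 b).

Lemma twist_neq0 i b : twist i b != 0.
Proof. by rewrite mulf_neq0 ?expfz_neq0 ?oppr_eq0. Qed.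

Lemma linextU (f : mono m n -> Om) b : linext f (x_mono k b) = f b.
Proof. exact: basis_extU. Qed.

Lemma linext_linear (f : mono m n -> Om) : linear (linext f).
Proof. exact: basis_ext_linear. Qed.

End Oscillators.

(** * Cancellation of the twists *)

Section Twist.
Context (k : fieldType) (q : k) (q_neq0 : q != 0) (q2_neq1 : q ^+ 2 != 1).
Context (m n : nat).
Notation I := 'I_(m + n).
Notation J := 'I_(m + n).-1.
Notation Om := (Omega k m n).
Implicit Types (b : mono m n) (i j : I) (c : nat) (v : Om).

Lemma expo_mono_eps i j : expo (mono_eps i) j = (j == i).
Proof.
rewrite /expo /mono_eps; case: (split_ordP i) => i0 ->.
  by case: (split_ordP j) => j0 -> /=; rewrite ffunE ?eq_lshift ?eq_rlshift.
by case: (split_ordP j) => j0 -> /=; rewrite ffunE ?eq_rshift ?eq_lrshift.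
Qed.

Lemma wt0_mono_eps i : wt0 (mono_eps i) = if (i < m)%N then eps i else 0.
Proof.
apply/ffunP => j; rewrite wt0E expo_mono_eps.
have [ji|ji] := eqVneq j i; first by rewrite ji; case: ifP; rewrite ffunE ?eqxx.
by case: ifP; case: ifP; rewrite ?ffunE // (negPf ji).
Qed.

Lemma wt1_mono_eps i : wt1 (mono_eps i) = if (i < m)%N then 0 else eps i.
Proof.
apply/ffunP => j; rewrite wt1E expo_mono_eps.
have [ji|ji] := eqVneq j i; first by rewrite ji; case: ifP; rewrite ffunE ?eqxx.
by case: ifP; case: ifP; rewrite ?ffunE // (negPf ji).
Qed.

Lemma star_eps_wt1 i b : (i < m)%N -> star (eps i) (wt1 b) = 0.
Proof.
move=> im; rewrite star_eps big1 // => j ji; rewrite wt1E ifT //.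
exact: ltn_trans ji im.
Qed.

Lemma mono_mul_twist i b (c := mono_eps i) :
  q ^ star (wt1 c) (wt0 b) * q ^ star (wt0 c) (wt0 b) *
    (- q) ^ star (wt1 c) (wt1 b) = twist q i b.
Proof.
rewrite /c wt0_mono_eps wt1_mono_eps /twist; case: ifP => im.
  by rewrite star_eps_wt1 // !star0l !expr0z mul1r.
by rewrite [star 0 _]star0l expr0z mulr1.
Qed.

Lemma mono_mul_qbin i b (c := mono_eps i) :
  \prod_j qbin q (c.1 j + b.1 j) (c.1 j) =
    if (i < m)%N then qnum q (expo b i).+1 else 1.
Proof.
rewrite /c /mono_eps /expo; case: split_ordP => i0 _.
  rewrite (bigD1 i0) //= ffunE eqxx add1n qbin1 // big1 ?mulr1 // => j /negPf ji.
  by rewrite ffunE ji qbin0.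
by rewrite big1 // => j _; rewrite ffunE qbin0.
Qed.

Lemma mono_mul_overlap i b :
  [exists j, (mono_eps i).2 j && b.2 j] = (m <= i)%N && (0 < expo b i)%N.
Proof.
rewrite /mono_eps /expo; case: (split_ordP i) => i0 -> /=.
  rewrite leqNgt ltn_ord /=; apply/existsP => -[j]; by rewrite ffunE.
rewrite leq_addr /=; apply/existsP/idP => [[j]|b0].
  by rewrite ffunE => /andP[/eqP-> ->].
by exists i0; rewrite ffunE eqxx; move: b0; case: (b.2 i0).
Qed.

Lemma mono_mul_mono i b :
  ([ffun j => ((mono_eps i).1 j + b.1 j)%N],
   [ffun j => (mono_eps i).2 j || b.2 j]) = upd b i (expo b i).+1 :> mono m n.
Proof.
rewrite /mono_eps /expo upd.unlock; case: split_ordP => i0 _ /=; congr (_, _);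
  apply/ffunP => j; rewrite !ffunE //; by case: (eqVneq j i0) => [->|].
Qed.

Lemma x_U i b : x_ q i (x_mono k b) = twist q i b *: raise q i (x_mono k b).
Proof.
rewrite /x_ /omul linextU linextU raiseU scalerA /mono_mul.
rewrite mono_mul_overlap mono_mul_mono mono_mul_qbin.
have -> (x y z u : k) : x * (y * z) * u = x * y * u * z by ring.
rewrite mono_mul_twist /rise leqNgt; case: (i < m)%N => //=.
by case: (expo b i) => [|c] //=; rewrite mulr0 scale0r.
Qed.

Lemma partial_U i b :
  partial_ q i (x_mono k b) = (twist q i b)^-1 *: lower i (x_mono k b).
Proof.
rewrite /partial_ linextU lowerU scalerA /twist invfM !invr_expz.
rewrite /expo upd.unlock; case: (split_ordP i) => i0 Di.
  rewrite star_eps_wt1 ?oppr0 ?expr0z ?mulr1; last by rewrite Di /=.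
  case: posnP => [|b0]; first by rewrite mulr0 scale0r.
  rewrite mulr1; congr (_ *: x_mono k _); congr (_, _).
  apply/ffunP => j; rewrite !ffunE; case: (eqVneq j i0) => [->|] /=; lia.
case b0: (b.2 i0); last by rewrite mulr0 scale0r.
rewrite mulr1; congr (_ *: x_mono k _); congr (_, _).
apply/ffunP => j; rewrite !ffunE /=.
by case: (eqVneq j i0) => [->|]; rewrite ?andbF ?andbT.
Qed.

Lemma sigma_opU i b :
  sigma_op q i (x_mono k b) = sigma_val q i b *: x_mono k b.
Proof. exact: linextU. Qed.

Lemma sigmaV_opU i b :
  sigmaV_op q i (x_mono k b) = (sigma_val q i b)^-1 *: x_mono k b.
Proof. exact: linextU. Qed.

Lemma sigma_valE i b :
  sigma_val q i b = q ^ wt0 b i * (- q) ^ wt1 b i.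
Proof.
rewrite wt0E wt1E /sigma_val /expo; case: (split_ordP i) => i0 _.
  by rewrite mulr1.
by rewrite mul1r.
Qed.

Lemma twist_hi (j : J) b :
  twist q (hi j) b = twist q (lo j) b * sigma_val q (lo j) b.
Proof.
rewrite /twist !star_eps_hi sigma_valE !expfzDr ?oppr_eq0 //; ring.
Qed.

Lemma twist_upd i j b c : (i <= j)%N -> twist q i (upd b j c) = twist q i b.
Proof.
move=> ij; rewrite /twist; congr (q ^ _ * (- q) ^ _); apply: star_eps_eq => l li.
  by rewrite !wt0E expo_upd -val_eqE ltn_eqF // (leq_trans li ij).
by rewrite !wt1E expo_upd -val_eqE ltn_eqF // (leq_trans li ij).
Qed.

Lemma sigma_val_upd i j b c : i != j ->
  sigma_val q i (upd b j c) = sigma_val q i b.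
Proof. by move=> ij; rewrite !sigma_valE !wt0E !wt1E expo_upd (negPf ij). Qed.

Lemma sigma_val_neq0 i b : sigma_val q i b != 0.
Proof. by rewrite sigma_valE mulf_neq0 // expfz_neq0 ?oppr_eq0. Qed.

Lemma x_linear i : linear (x_ q i : Om -> Om).
Proof.
have xE w : x_ q i w = linext (mono_mul q (mono_eps i)) w by apply: linextU.
by move=> a u v; rewrite !xE linext_linear.
Qed.

Lemma partial_linear i : linear (partial_ q i : Om -> Om).
Proof. exact: linext_linear. Qed.

Lemma diag_op_linear (c : mono m n -> k) : linear (diag_op c : Om -> Om).
Proof. exact: linext_linear. Qed.

HB.instance Definition _ i :=
  GRing.isLinear.Build k Om Om *:%R (x_ q i : Om -> Om) (x_linear i).
HB.instance Definition _ i :=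
  GRing.isLinear.Build k Om Om *:%R (partial_ q i : Om -> Om) (partial_linear i).
HB.instance Definition _ (c : mono m n -> k) :=
  GRing.isLinear.Build k Om Om *:%R (diag_op c : Om -> Om) (diag_op_linear c).
HB.instance Definition _ i :=
  GRing.Linear.copy (sigma_op q i : Om -> Om) (diag_op (sigma_val q i)).
HB.instance Definition _ i :=
  GRing.Linear.copy (sigmaV_op q i : Om -> Om)
    (diag_op (fun b => (sigma_val q i b)^-1)).
HB.instance Definition _ (j : J) :=
  GRing.Linear.copy (E_op q j : Om -> Om)
    (x_ q (lo j) \o (partial_ q (hi j) \o sigma_op q (lo j))).
HB.instance Definition _ (j : J) :=
  GRing.Linear.copy (F_op q j : Om -> Om)
    (sigmaV_op q (lo j) \o (x_ q (hi j) \o partial_ q (lo j))).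

(** The factor of the derivation at j+1 exceeds that of x_j by sigma_j, which
    E_j contains; lowering at j+1 does not affect the twist at j. *)
Lemma E_opE (j : J) v :
  E_op q j v = raise q (lo j) (lower (hi j) v).
Proof.
have j_hi := lo_neq_hi j.
have lohi : (lo j <= hi j)%N by apply: leqnSn.
pose F : {linear Om -> Om} := raise q (lo j) \o lower (hi j).
apply: (@Omega_linear_eq _ _ _ (E_op q j) F) => b; rewrite /F /= {F}.
rewrite /E_op sigma_opU [partial_ _ _ _]linearZ /= partial_U lowerU.
rewrite [raise _ _ _]linearZ /=; do 3![rewrite [x_ q _ _]linearZ /=].
rewrite x_U (twist_upd _ _ lohi) twist_hi !scalerA; apply: scaler_congr.
have [s0 t0] := (sigma_val_neq0 (lo j) b, twist_neq0 q_neq0 (lo j) b).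
by field; rewrite s0 t0.
Qed.

(** Here sigma_j^-1 acts last, on the exponent already lowered by the derivation
    at j, and the twist at j+1 is computed with the same exponent. *)
Lemma F_opE (j : J) v :
  F_op q j v = raise q (hi j) (lower (lo j) v).
Proof.
have j_hi := lo_neq_hi j.
pose F : {linear Om -> Om} := raise q (hi j) \o lower (lo j).
apply: (@Omega_linear_eq _ _ _ (F_op q j) F) => b; rewrite /F /= {F}.
rewrite /F_op partial_U lowerU [raise _ _ _]linearZ /=.
do 2![rewrite [x_ q _ _]linearZ /=].
rewrite x_U raiseU !scalerA [sigmaV_op _ _ _]linearZ /= sigmaV_opU.
rewrite (sigma_val_upd _ _ j_hi) twist_hi (twist_upd _ _ (leqnn _)) !scalerA.
apply: scaler_congr.
have s0 := sigma_val_neq0 (lo j) (upd b (lo j) (expo b (lo j)).-1).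
have t0 := twist_neq0 q_neq0 (lo j) b.
by field; rewrite s0 t0.
Qed.

Lemma K_valE i b : K_val q i b = qi q i ^+ expo b i.
Proof.
rewrite /K_val /qi /expo /sigma_val; case: (split_ordP i) => i0 _ //.
by rewrite -exprMn mulrN1 opprK exprVn.
Qed.

Lemma diag_opU (c : mono m n -> k) b : diag_op c (x_mono k b) = c b *: x_mono k b.
Proof. exact: linextU. Qed.

End Twist.

(** * Relations between ladder operators *)

Section LadderRelations.
Context (k : fieldType) (e : k) (m n : nat) (V : lmodType k).
Notation I := 'I_(m + n).
Notation J := 'I_(m + n).-1.
(** R and L enter symmetrically: exchanging them turns E_j = R_j L_(j+1) into
    L_j R_(j+1) = F_j, so each lemma serves for both families. *)
Context (R L : I -> {linear V -> V}).
Context (RR : forall (i j : I) v, R i (R j v) = R j (R i v)).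
Context (LL : forall (i j : I) v, L i (L j v) = L j (L i v)).
Context (RL : forall (i j : I) v, i != j -> R i (L j v) = L j (R i v)).
Context (R2 : forall (i : I) v, (m <= i)%N -> R i (R i v) = 0).
Context (L2 : forall (i : I) v, (m <= i)%N -> L i (L i v) = 0).
Context (LLR : forall (i : I) v, (i < m)%N ->
  L i (L i (R i v)) - e *: L i (R i (L i v)) + R i (L i (L i v)) = 0).
Context (RRL : forall (i : I) v, (i < m)%N ->
  R i (R i (L i v)) - e *: R i (L i (R i v)) + L i (R i (R i v)) = 0).

Context (E : J -> V -> V).
Context (EE : forall (j : J) v, E j v = R (lo j) (L (hi j) v)).

Lemma ladder_far i j v : far i j -> E i (E j v) = E j (E i v).
Proof.
move=> ij; have [ne1 ne2] : lo i != hi j /\ lo j != hi i.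
  by move: ij; rewrite /far -!val_eqE /=; lia.
by rewrite !EE -[L (hi i) _]RL // RR [L (hi i) (L _ _)]LL [R (lo i) _]RL.
Qed.

Lemma ladder_nilp i v : (m <= (hi i))%N -> E i (E i v) = 0.
Proof.
move=> mi; have ne := lo_neq_hi i.
by rewrite !EE -[L _ (R _ _)]RL // L2 // !linear0.
Qed.

(** The nodes i and j share one site s.  Moving all other factors to the left
    leaves the single-site relation at s when s is even; when i lies beyond the
    odd node, an odd site is raised or lowered twice in every term. *)
Lemma ladder_Serre i j v : adjacent i j -> ~~ odd_node i ->
  E i (E i (E j v)) - e *: E i (E j (E i v)) + E j (E i (E i v)) = 0.
Proof.
move=> adj even_i; rewrite !EE; have [ij|ji] : (lo j = hi i) \/ (hi j = lo i).
  by case/orP: adj => /eqP; [left | right]; apply: val_inj.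
- rewrite ij; set a := lo i; set s := hi i; set c := hi j.
  have sa : s != a by rewrite eq_sym lo_neq_hi.
  have sc : s != c by rewrite /s -ij lo_neq_hi.
  have ac : a != c by move: ij => /(congr1 val); rewrite -val_eqE /=; lia.
  have r1 w : R s (L c w) = L c (R s w) by apply: RL.
  have r2 w : L s (L c w) = L c (L s w) by apply: LL.
  have r3 w : L s (R a w) = R a (L s w) by rewrite RL // eq_sym.
  have r4 w : L c (R a w) = R a (L c w) by rewrite RL.
  have r5 w : R s (R a w) = R a (R s w) by apply: RR.
  rewrite !(r1, r2, r3, r4, r5).
  have [sm|ms] := ltnP s m.
    by have /(congr1 (R a \o (R a \o L c))) := LLR v sm;
      rewrite /= !linearD !linearN !linearZ !linear0.
  have ma : (m <= a)%N by move: ms even_i; rewrite /odd_node /=; lia.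
  by rewrite !R2 // scaler0 subrr addr0.
rewrite ji; set a := lo j; set s := lo i; set c := hi i.
have sa : s != a by move: ji => /(congr1 val); rewrite -val_eqE /=; lia.
have sc : s != c by rewrite lo_neq_hi.
have ac : a != c by move: ji => /(congr1 val); rewrite -val_eqE /=; lia.
have r1 w : R s (L c w) = L c (R s w) by apply: RL.
have r2 w : L s (L c w) = L c (L s w) by apply: LL.
have r3 w : L s (R a w) = R a (L s w) by rewrite RL // eq_sym.
have r4 w : L c (R a w) = R a (L c w) by rewrite RL.
have r5 w : R s (R a w) = R a (R s w) by apply: RR.
rewrite !(r1, r2, r3, r4, r5).
have [sm|ms] := ltnP s m.
  by have /(congr1 (R a \o (L c \o L c))) := RRL v sm;
    rewrite /= !linearD !linearN !linearZ !linear0.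
have mc : (m <= c)%N by apply: leq_trans ms (leqnSn _).
by rewrite !L2 // !linear0 !addr0.
Qed.

(** Node i straddles the even site A and the odd site B.  Two of the five terms
    contain the square of an operator at B; the other three agree at B and form
    the single-site relation at A. *)
Lemma ladder_Serre4 (h i j : J) v :
    odd_node i -> i = h.+1 :> nat -> j = i.+1 :> nat ->
  E h (E i (E j (E i v))) + E i (E h (E i (E j v))) + E j (E i (E h (E i v)))
    + E i (E j (E i (E h v))) - e *: E i (E h (E j (E i v))) = 0.
Proof.
rewrite /odd_node !EE => odd_i ih ji.
have -> : hi h = lo i by apply: val_inj.
have -> : lo j = hi i by apply: val_inj.
set x := lo h; set A := lo i; set B := hi i; set y := hi j.
have xA : A != x by rewrite -val_eqE /=; lia.
have xB : B != x by rewrite -val_eqE /=; lia.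
have xy : x != y by rewrite -val_eqE /=; lia.
have AB : A != B by rewrite -val_eqE /=; lia.
have Ay : A != y by rewrite -val_eqE /=; lia.
have By : B != y by rewrite -val_eqE /=; lia.
have x1 w : L A (R x w) = R x (L A w) by rewrite RL // eq_sym.
have x2 w : L B (R x w) = R x (L B w) by rewrite RL // eq_sym.
have x3 w : L y (R x w) = R x (L y w) by rewrite RL.
have x4 w : R A (R x w) = R x (R A w) by apply: RR.
have x5 w : R B (R x w) = R x (R B w) by apply: RR.
have y1 w : L A (L y w) = L y (L A w) by apply: LL.
have y2 w : L B (L y w) = L y (L B w) by apply: LL.
have y3 w : R A (L y w) = L y (R A w) by apply: RL.
have y4 w : R B (L y w) = L y (R B w) by apply: RL.
have b1 w : L B (L A w) = L A (L B w) by apply: LL.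
have b2 w : L B (R A w) = R A (L B w) by rewrite RL.
have b3 w : R B (R A w) = R A (R B w) by apply: RR.
have b4 w : R B (L A w) = L A (R B w) by apply: RL; rewrite eq_sym.
rewrite !(x1, x2, x3, x4, x5, y1, y2, y3, y4, b1, b2, b3, b4).
have mB : (m <= B)%N by move: odd_i => /=; lia.
have Am : (A < m)%N by move: odd_i => /=; lia.
rewrite !(L2 _ mB) !linear0 !addr0.
set z := L B _.
have Ez : e *: R A (L A (R A z)) = L A (R A (R A z)) + R A (R A (L A z)).
  by have /eqP := RRL z Am; rewrite addrAC subr_eq0 addrC => /eqP.
have eZ w : e *: R x (L y w) = R x (L y (e *: w)) by rewrite !linearZ.
by rewrite eZ Ez [L y (_ + _)]linearD [R x (_ + _)]linearD subrr.
Qed.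

Context (F : J -> V -> V).
Context (FE : forall (j : J) v, F j v = L (lo j) (R (hi j) v)).

Lemma ladder_EF_neq (i j : J) v : i != j -> E i (F j v) = F j (E i v).
Proof.
move=> ij; have [lo_ij hi_ij] : lo i != lo j /\ hi j != hi i.
  by split; [ | rewrite eq_sym]; apply: contra_neq ij => -[] ?; apply: val_inj.
rewrite !EE !FE [L (hi i) (L _ _)]LL [R (lo i) (L _ _)]RL //; congr (L _ _).
by rewrite [RHS]RR -[L (hi i) _]RL.
Qed.

Lemma ladder_EF (j : J) v :
  E j (F j v) = R (lo j) (L (lo j) (L (hi j) (R (hi j) v))).
Proof. by rewrite EE FE [L (hi j) (L _ _)]LL. Qed.

Lemma ladder_FE (j : J) v :
  F j (E j v) = L (lo j) (R (lo j) (R (hi j) (L (hi j) v))).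
Proof. by rewrite EE FE [R (hi j) (R _ _)]RR. Qed.

End LadderRelations.

(** * Moves between sites *)

Section Action.
Context (k : fieldType) (q : k) (q_neq0 : q != 0) (q2_neq1 : q ^+ 2 != 1).
Context (m n : nat).
Notation I := 'I_(m + n).
Notation J := 'I_(m + n).-1.
Notation Om := (Omega k m n).
Implicit Types (b : mono m n) (v : Om) (g : gtype).

(** The monomial obtained by moving one unit of exponent from j to i. *)
Definition shift b (i j : I) : mono m n :=
  upd (upd b j (expo b j).-1) i (expo b i).+1.

Definition shift_coef b (i j : I) : k :=
  (0 < expo b j)%:R * rise q i (expo b i).

Lemma raise_lowerU (i j : I) b : i != j ->
  raise q i (lower j (x_mono k b)) = shift_coef b i j *: x_mono k (shift b i j).
Proof.
by move=> ij; rewrite lowerU linearZ /= raiseU scalerA expo_upd (negPf ij).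
Qed.

Lemma expo_odd_le1 b (i : I) : (m <= i)%N -> (expo b i <= 1)%N.
Proof. by rewrite -trunc_expo /trunc ltnNge => -> /=; case: (_ < _)%N. Qed.

(** The nonzero coefficient guarantees that nothing was truncated. *)
Lemma expo_shift b (i j l : I) : i != j -> shift_coef b i j != 0 ->
  (expo (shift b i j) l)%:Z = (expo b l)%:Z + (l == i)%:Z - (l == j)%:Z.
Proof.
move=> ij; rewrite mulf_eq0 negb_or => /andP[bj bi].
have {}bj : (0 < expo b j)%N by move: bj; case: (0 < _)%N; rewrite ?eqxx.
have bi1 : trunc i (expo b i).+1 = (expo b i).+1.
  move: bi; rewrite /trunc /rise; case: ifP => // _.
  by case: (expo b i) => // c; rewrite eqxx.
have bj1 : trunc j (expo b j).-1 = (expo b j).-1.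
  rewrite /trunc; case: ltnP => // /(expo_odd_le1 b).
  by case: (expo b j) => [|[]].
rewrite /shift !expo_upd bi1 bj1.
have [->|li] := eqVneq l i; first by rewrite (negPf ij) /=; clear; lia.
by have [->|lj] := eqVneq l j; rewrite /=; clear -bj; lia.
Qed.

Lemma diag_op_comp (c d : mono m n -> k) v :
  diag_op c (diag_op d v) = diag_op (fun b => c b * d b) v.
Proof.
apply: (@Omega_linear_eq _ _ _ (diag_op c \o diag_op d)
  (diag_op (fun b => c b * d b))) => b.
by rewrite /= !diag_opU linearZ /= diag_opU scalerA mulrC.
Qed.

Lemma diag_op_comm (c d : mono m n -> k) v :
  diag_op c (diag_op d v) = diag_op d (diag_op c v).
Proof.
apply: (@Omega_linear_eq _ _ _ (diag_op c \o diag_op d)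
  (diag_op d \o diag_op c)) => b.
by rewrite /= !diag_opU !linearZ /= !diag_opU !scalerA mulrC.
Qed.

Lemma eq_diag_op (c d : mono m n -> k) v : c =1 d -> diag_op c v = diag_op d v.
Proof.
move=> cd; apply: (@Omega_linear_eq _ _ _ (diag_op c) (diag_op d)) => b.
by rewrite /= !diag_opU cd.
Qed.

Lemma diag_op1 (c : mono m n -> k) v : c =1 (fun=> 1) -> diag_op c v = v.
Proof.
move=> c1; apply: (@Omega_linear_eq _ _ _ (diag_op c) idfun) => b.
by rewrite /= diag_opU c1 scale1r.
Qed.

Lemma diag_op_comb (s e : k) (c1 c2 d1 d2 : mono m n -> k) v :
    (forall b, c1 b - s * c2 b = e * (d1 b - d2 b)) ->
  diag_op c1 v - s *: diag_op c2 v = e *: (diag_op d1 v - diag_op d2 v).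
Proof.
move=> cd; apply: (@Omega_linear_eq _ _ _ (diag_op c1 \- (s \*: diag_op c2))
  (e \*: (diag_op d1 \- diag_op d2))) => b.
by rewrite /= !diag_opU; apply: scale_comb.
Qed.

(** A diagonal operator whose eigenvalue is scaled by a under the move
    commutes with the move up to a. *)
Lemma diag_op_shift (c : mono m n -> k) (i j : I) a v : i != j ->
    (forall b, shift_coef b i j != 0 -> c (shift b i j) = a * c b) ->
  diag_op c (raise q i (lower j v)) = a *: raise q i (lower j (diag_op c v)).
Proof.
move=> ij ca; pose T : {linear Om -> Om} := raise q i \o lower j.
apply: (@Omega_linear_eq _ _ _ (diag_op c \o T) (a \*: (T \o diag_op c))) => b.
rewrite /= diag_opU [lower j (_ *: _)]linearZ /= [raise _ _ (_ *: _)]linearZ /=.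
rewrite raise_lowerU // linearZ /= diag_opU !scalerA; apply: scaler_congr.
have [-> | /ca ->] := eqVneq (shift_coef b i j) 0; first by rewrite mul0r mulr0.
by ring.
Qed.

Definition raise_lower_val (i : I) c : k := if (i < m)%N then qnum q c else c%:R.
Definition lower_raise_val (i : I) c : k :=
  if (i < m)%N then qnum q c.+1 else (c == 0%N)%:R.

Lemma raise_lower_diag (i : I) v :
  raise q i (lower i v) = diag_op (fun b => raise_lower_val i (expo b i)) v.
Proof.
pose T : {linear Om -> Om} := raise q i \o lower i.
apply: (@Omega_linear_eq _ _ _ T (diag_op (fun b => raise_lower_val i (expo b i)))) => b.
rewrite /T /= diag_opU /raise /lower site_comp.
have Db : upd b i (trunc i (expo b i).-1).+1 = b \/ expo b i = 0%N.
  case b0: (expo b i) => [|c]; [by right | left].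
  apply: mono_ext => l; rewrite expo_upd; case: eqVneq => // ->.
  rewrite -[RHS]trunc_expo /trunc b0 /=.
  by case: (ltnP i m) => // /(expo_odd_le1 b); rewrite b0; case: (c).
rewrite /raise_lower_val /rise /trunc; case: Db => [Db | ->].
  rewrite /trunc in Db; rewrite Db; apply: scaler_congr.
  case: (ltnP i m) => [im | /(expo_odd_le1 b)].
    by case: (expo b i) => [|c]; rewrite ?qnum0 ?mul0r ?mul1r.
  by case: (expo b i) => [|[|]]; rewrite ?mul0r ?mul1r.
by rewrite mul0r !scale0r; case: ifP; rewrite ?qnum0 scale0r.
Qed.

Lemma lower_raise_diag (i : I) v :
  lower i (raise q i v) = diag_op (fun b => lower_raise_val i (expo b i)) v.
Proof.
pose T : {linear Om -> Om} := lower i \o raise q i.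
apply: (@Omega_linear_eq _ _ _ T (diag_op (fun b => lower_raise_val i (expo b i)))) => b.
rewrite /T /= diag_opU /raise /lower site_comp -/(lower_raise_val _ _).
have Db : upd b i (trunc i (expo b i).+1).-1 = b \/ lower_raise_val i (expo b i) = 0.
  rewrite /lower_raise_val /trunc; case: (ltnP i m) => im.
    by left; apply: mono_ext => l; rewrite expo_upd /= trunc_expo; case: eqVneq => // ->.
  case b0: (expo b i) => [|c]; [left | by right].
  apply: mono_ext => l; rewrite expo_upd /= /trunc ltnNge im /=.
  by case: eqVneq => // ->.
have -> : rise q i (expo b i) = lower_raise_val i (expo b i) by [].
case: Db => [-> | ->]; last by rewrite mul0r !scale0r.
apply: scaler_congr; rewrite /trunc; case: ifP; rewrite ?mulr1 //.
Qed.

Definition cartan_val g : cartan m n g -> mono m n -> k :=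
  match g with
  | GL => fun i => K_val q i
  | SL => fun j b => K_val q (lo j) b / K_val q (hi j) b
  end.

Lemma K_opE g (a : cartan m n g) v : K_op q a v = diag_op (cartan_val a) v.
Proof. by case: g a. Qed.

Lemma K_val_neq0 (i : I) b : K_val q i b != 0.
Proof.
by rewrite K_valE expf_neq0 // /qi; case: ifP => _; rewrite ?invr_eq0.
Qed.

Lemma cartan_val_neq0 g (a : cartan m n g) b : cartan_val a b != 0.
Proof.
by case: g a => a; rewrite /= ?mulf_neq0 ?invr_eq0 ?K_val_neq0.
Qed.

Definition gen_op g (x : gen m n g) : {linear Om -> Om} :=
  match x with
  | gE j => E_op q j
  | gF j => F_op q j
  | gK a => diag_op (cartan_val a)
  | gKinv a => diag_op (fun b => (cartan_val a b)^-1)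
  | gSigma => diag_op (fun b => (-1) ^+ (\sum_i b.2 i)%N)
  end.

End Action.

(** * Relations among the operators E_j and F_j *)

Section Relations.
Context (k : fieldType) (q : k) (q_neq0 : q != 0) (q2_neq1 : q ^+ 2 != 1).
Context (m n : nat).
Notation I := 'I_(m + n).
Notation J := 'I_(m + n).-1.
Notation Om := (Omega k m n).
Implicit Types (b : mono m n) (v : Om).

Lemma F_op_lower_raise (j : J) v :
  F_op q j v = lower (lo j) (raise q (hi j) v).
Proof. by rewrite F_opE // raise_lower_comm // eq_sym lo_neq_hi. Qed.

Lemma lower_raise_comm (i j : I) v : i != j ->
  lower i (raise q j v) = raise q j (lower i v).
Proof. by move=> ij; rewrite raise_lower_comm // eq_sym. Qed.

Let R (i : I) : {linear Om -> Om} := raise q i.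
Let L (i : I) : {linear Om -> Om} := @lower k m n i.
Let RR : forall (i j : I) v, R i (R j v) = R j (R i v).
Proof. exact: raise_comm. Qed.
Let LL : forall (i j : I) v, L i (L j v) = L j (L i v).
Proof. exact: lower_comm. Qed.
Let RL : forall (i j : I) v, i != j -> R i (L j v) = L j (R i v).
Proof. exact: raise_lower_comm. Qed.
Let LR : forall (i j : I) v, i != j -> L i (R j v) = R j (L i v).
Proof. exact: lower_raise_comm. Qed.
Let R2 : forall (i : I) v, (m <= i)%N -> R i (R i v) = 0.
Proof. exact: raise2_odd. Qed.
Let L2 : forall (i : I) v, (m <= i)%N -> L i (L i v) = 0.
Proof. exact: lower2_odd. Qed.
Let LLR : forall (i : I) v, (i < m)%N ->
  L i (L i (R i v)) - (q + q^-1) *: L i (R i (L i v)) + R i (L i (L i v)) = 0.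
Proof. by move=> i v; apply: Serre_lower. Qed.
Let RRL : forall (i : I) v, (i < m)%N ->
  R i (R i (L i v)) - (q + q^-1) *: R i (L i (R i v)) + L i (R i (R i v)) = 0.
Proof. by move=> i v; apply: Serre_raise. Qed.

Let EE (j : J) v : E_op q j v = R (lo j) (L (hi j) v).
Proof. exact: E_opE. Qed.
Let FE (j : J) v : F_op q j v = L (lo j) (R (hi j) v).
Proof. exact: F_op_lower_raise. Qed.

Lemma E_op_far i j v : far i j -> E_op q i (E_op q j v) = E_op q j (E_op q i v).
Proof. exact: (ladder_far RR LL RL EE). Qed.

Lemma F_op_far i j v : far i j -> F_op q i (F_op q j v) = F_op q j (F_op q i v).
Proof. exact: (ladder_far LL RR LR FE). Qed.

Lemma E_op_nilp (i : J) v : (m <= hi i)%N -> E_op q i (E_op q i v) = 0.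
Proof. exact: (ladder_nilp RL L2 EE). Qed.

Lemma F_op_nilp (i : J) v : (m <= hi i)%N -> F_op q i (F_op q i v) = 0.
Proof. exact: (ladder_nilp LR R2 FE). Qed.

Lemma E_op_Serre (i j : J) v : adjacent i j -> ~~ odd_node i ->
  E_op q i (E_op q i (E_op q j v)) - (q + q^-1) *: E_op q i (E_op q j (E_op q i v))
    + E_op q j (E_op q i (E_op q i v)) = 0.
Proof. exact: (ladder_Serre RR LL RL R2 L2 LLR RRL EE). Qed.

Lemma F_op_Serre (i j : J) v : adjacent i j -> ~~ odd_node i ->
  F_op q i (F_op q i (F_op q j v)) - (q + q^-1) *: F_op q i (F_op q j (F_op q i v))
    + F_op q j (F_op q i (F_op q i v)) = 0.
Proof. exact: (ladder_Serre LL RR LR L2 R2 RRL LLR FE). Qed.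

Lemma E_op_Serre4 (h i j : J) v :
    odd_node i -> i = h.+1 :> nat -> j = i.+1 :> nat ->
  E_op q h (E_op q i (E_op q j (E_op q i v)))
    + E_op q i (E_op q h (E_op q i (E_op q j v)))
    + E_op q j (E_op q i (E_op q h (E_op q i v)))
    + E_op q i (E_op q j (E_op q i (E_op q h v)))
    - (q + q^-1) *: E_op q i (E_op q h (E_op q j (E_op q i v))) = 0.
Proof. exact: (ladder_Serre4 RR LL RL L2 RRL EE). Qed.

Lemma F_op_Serre4 (h i j : J) v :
    odd_node i -> i = h.+1 :> nat -> j = i.+1 :> nat ->
  F_op q h (F_op q i (F_op q j (F_op q i v)))
    + F_op q i (F_op q h (F_op q i (F_op q j v)))
    + F_op q j (F_op q i (F_op q h (F_op q i v)))
    + F_op q i (F_op q j (F_op q i (F_op q h v)))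
    - (q + q^-1) *: F_op q i (F_op q h (F_op q j (F_op q i v))) = 0.
Proof. exact: (ladder_Serre4 LL RR LR R2 LLR FE). Qed.

Lemma EF_op_neq (i j : J) v : i != j ->
  E_op q i (F_op q j v) = F_op q j (E_op q i v).
Proof. exact: (ladder_EF_neq RR LL RL EE FE). Qed.

Lemma EF_op_diag (j : J) v : E_op q j (F_op q j v) =
  diag_op (fun b => raise_lower_val q (lo j) (expo b (lo j))
                    * lower_raise_val q (hi j) (expo b (hi j))) v.
Proof.
have LRd w : L (hi j) (R (hi j) w) = _ := lower_raise_diag _ _ _.
have RLd w : R (lo j) (L (lo j) w) = _ := raise_lower_diag _ _ _.
by rewrite (ladder_EF LL EE FE) LRd RLd diag_op_comp.
Qed.

Lemma FE_op_diag (j : J) v : F_op q j (E_op q j v) =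
  diag_op (fun b => lower_raise_val q (lo j) (expo b (lo j))
                    * raise_lower_val q (hi j) (expo b (hi j))) v.
Proof.
have LRd w : L (lo j) (R (lo j) w) = _ := lower_raise_diag _ _ _.
have RLd w : R (hi j) (L (hi j) w) = _ := raise_lower_diag _ _ _.
by rewrite (ladder_FE RR EE FE) RLd LRd diag_op_comp.
Qed.

(** At an even node this is [a][c+1] - [a+1][c] = [a-c]; at a node with an odd
    site the exponent c there (and a, if both are odd) is 0 or 1. *)
Lemma raise_lower_commutator (j : J) b :
  let a := expo b (lo j) in let c := expo b (hi j) in
  let K := K_val q (lo j) b / K_val q (hi j) b in
  raise_lower_val q (lo j) a * lower_raise_val q (hi j) c
    - (-1) ^+ odd_node j * (lower_raise_val q (lo j) a * raise_lower_val q (hi j) c) =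
  (qi q (lo j) - (qi q (lo j))^-1)^-1 * (K - K^-1).
Proof.
move=> a c K; rewrite /K !K_valE -/a -/c /raise_lower_val /lower_raise_val /qi /odd_node /=.
have [aodd codd] := (@expo_odd_le1 m n b (lo j), @expo_odd_le1 m n b (hi j)).
have qq := q_subV_neq0 q_neq0 q2_neq1.
have q12 : 1 - q * q != 0 by rewrite subr_eq0 eq_sym -expr2.
have q21 : q * q - 1 != 0 by rewrite subr_eq0 -expr2.
case: (ltngtP j.+1 m) => jm.
- rewrite expr0 mul1r; apply: (mulfI qq); rewrite qnumB // mulVKf // invf_div.
  by congr (_ - _); rewrite mulrC.
- rewrite expr0 mul1r.
  have {}aodd : (a <= 1)%N by apply: aodd; rewrite -ltnS.
  have {}codd : (c <= 1)%N by apply: codd; rewrite ltnW.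
  by case: (a) aodd => [|[|]] // _; case: (c) codd => [|[|]] // _;
    rewrite ?expr0 ?expr1 ?invr1 /=; field;
    rewrite ?oner_eq0 ?q_neq0 ?mulNr ?q21 ?q12.
have {}codd : (c <= 1)%N by apply: codd; rewrite /= jm.
have x0 : q ^+ a != 0 by rewrite expf_neq0.
by case: (c) codd => [|[|]] // _; rewrite /= ?expr0 ?expr1 /qnum ?exprS; field;
  rewrite ?oner_eq0 ?q_neq0 ?mulNr ?q21 ?q12 ?x0.
Qed.

End Relations.

(** * The defining relations on the Grassmann superalgebra *)

Section UqModule.
Context (k : fieldType) (q : k) (q_neq0 : q != 0) (q2_neq1 : q ^+ 2 != 1).
Context (m n : nat).
Notation I := 'I_(m + n).
Notation J := 'I_(m + n).-1.
Notation Om := (Omega k m n).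
Implicit Types (b : mono m n) (v : Om).

Lemma qi_neq0 (i : I) : qi q i != 0.
Proof. by rewrite /qi; case: ifP; rewrite ?invr_eq0. Qed.

Lemma K_val_shift b (i j l : I) : i != j -> shift_coef q b i j != 0 ->
  K_val q l (shift b i j) = qi q l ^ ((l == i)%:Z - (l == j)%:Z) * K_val q l b.
Proof.
move=> ij nz; rewrite !K_valE.
have XE c : qi q l ^+ c = qi q l ^ c%:Z by [].
by rewrite !XE (expo_shift _ ij nz) mulrC -expfzDr ?qi_neq0 // addrA.
Qed.

Lemma cartan_val_E g (a : cartan m n g) (j : J) b :
    shift_coef q b (lo j) (hi j) != 0 ->
  cartan_val q a (shift b (lo j) (hi j)) = kfac q a j * cartan_val q a b.
Proof.
case: g a => a nz; rewrite /cartan_val !K_val_shift ?lo_neq_hi //.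
by rewrite /kfac invfM mulrACA.
Qed.

Lemma cartan_val_F g (a : cartan m n g) (j : J) b :
    shift_coef q b (hi j) (lo j) != 0 ->
  cartan_val q a (shift b (hi j) (lo j)) = (kfac q a j)^-1 * cartan_val q a b.
Proof.
have hilo : hi j != lo j by rewrite eq_sym lo_neq_hi.
move=> nz; have KF l : K_val q l (shift b (hi j) (lo j)) =
    (qi q l ^ ((l == lo j)%:Z - (l == hi j)%:Z))^-1 * K_val q l b.
  by rewrite K_val_shift // invr_expz opprB.
case: g a => a; rewrite /cartan_val /kfac !KF //.
by rewrite !invfM !invrK mulrACA.
Qed.

Lemma diag_E_op (c : mono m n -> k) (j : J) a v :
    (forall b, shift_coef q b (lo j) (hi j) != 0 ->
      c (shift b (lo j) (hi j)) = a * c b) ->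
  diag_op c (E_op q j v) = a *: E_op q j (diag_op c v).
Proof. by move=> ca; rewrite !E_opE // (diag_op_shift (a := a)) // lo_neq_hi. Qed.

Lemma diag_F_op (c : mono m n -> k) (j : J) a v :
    (forall b, shift_coef q b (hi j) (lo j) != 0 ->
      c (shift b (hi j) (lo j)) = a * c b) ->
  diag_op c (F_op q j v) = a *: F_op q j (diag_op c v).
Proof.
by move=> ca; rewrite !F_opE // (diag_op_shift (a := a)) // eq_sym lo_neq_hi.
Qed.

Definition parity_val b : k := (-1) ^+ (\sum_i b.2 i)%N.

(** Written as a sum over all sites, the parity can be compared before and after
    a move by expo_shift. *)
Lemma parity_valE b :
  parity_val b = (-1) ^ (\sum_(i < m + n) (m <= i)%N%:Z * (expo b i)%:Z).
Proof.
rewrite /parity_val big_split_ord /= [X in X + _]big1 ?add0r => [|i _]; last first.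
  by rewrite leqNgt ltn_ord mul0r.
rewrite exprnP; congr (_ ^ _); rewrite (big_morph Posz PoszD (erefl _)).
by apply: eq_bigr => i _; rewrite /= leq_addr mul1r /expo split_rshift.
Qed.

Lemma parity_shift b (i j : I) : i != j -> shift_coef q b i j != 0 ->
  parity_val (shift b i j) =
    (-1) ^ ((m <= i)%N%:Z - (m <= j)%N%:Z) * parity_val b.
Proof.
move=> ij nz; rewrite !parity_valE -expfzDr ?oppr_eq0 ?oner_eq0 //.
congr (_ ^ _).
have delta (h : I) :
    (m <= h)%N%:Z = \sum_(l < m + n) (m <= l)%N%:Z * (l == h)%:Z.
  rewrite (bigD1 h) //= eqxx mulr1 big1 ?addr0 // => l /negPf->.
  by rewrite mulr0.
rewrite [in RHS]delta [in X in _ - X]delta -sumrB -big_split /=.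
apply: eq_bigr => l _; rewrite (expo_shift _ ij nz); ring.
Qed.

Lemma parity_E b (j : J) : shift_coef q b (lo j) (hi j) != 0 ->
  parity_val (shift b (lo j) (hi j)) = (-1) ^+ odd_node j * parity_val b.
Proof.
move=> nz; rewrite parity_shift ?lo_neq_hi // /odd_node /=; congr (_ * _).
rewrite -(ltnS m j); case: (ltngtP j.+1 m) => // _.
by rewrite (_ : 0%Z - 1 = -1) // exprN1 invrN1.
Qed.

Lemma parity_F b (j : J) : shift_coef q b (hi j) (lo j) != 0 ->
  parity_val (shift b (hi j) (lo j)) = (-1) ^+ odd_node j * parity_val b.
Proof.
have hilo : hi j != lo j by rewrite eq_sym lo_neq_hi.
move=> nz; rewrite parity_shift // /odd_node /=; congr (_ * _).
by rewrite -(ltnS m j); case: (ltngtP j.+1 m).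
Qed.

Section Generators.
Context (g : gtype).
Notation A := (free_alg k m n g).
Implicit Types x y : A.
(** The lemmas below rewrite the action of each side of a relation as a
    composite of the actions of its letters. *)
Context (rho : A -> Om -> Om).
Context (rhoM : forall x y v, rho (x * y) v = rho x (rho y v)).
Context (rhoD : forall x y v, rho (x + y) v = rho x v + rho y v).
Context (rho1 : forall v, rho 1 v = v).
Context (rhoZ : forall (a : k) x v, rho (a *: x) v = a *: rho x v).
Context (rhoG : forall (x : gen m n g) v, rho (fgen k x) v = gen_op q x v).

Let rhoX2 x v : rho (x ^+ 2) v = rho x (rho x v).
Proof. exact: rhoM. Qed.
Let rho0 v : rho 0 v = 0.
Proof. by rewrite -(scale0r (0 : A)) rhoZ scale0r. Qed.
Let rhoN x v : rho (- x) v = - rho x v.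
Proof. by rewrite -scaleN1r rhoZ scaleN1r. Qed.
Let rhoB x y v : rho (x - y) v = rho x v - rho y v.
Proof. by rewrite rhoD rhoN. Qed.
Let rhoS (d : nat) x v : rho ((-1) ^+ d * x) v = (-1) ^+ d *: rho x v.
Proof.
rewrite -!(signr_odd _ d); case: (odd d);
  by rewrite ?expr0 ?expr1 ?mul1r ?mulN1r ?scale1r ?scaleN1r ?rhoN.
Qed.
Let rhoM3 x y z v : rho (x * y * z) v = rho x (rho y (rho z v)).
Proof. exact: etrans (rhoM _ _ _) (rhoM _ _ _). Qed.
Let rhoM4 x y z t v : rho (x * y * z * t) v = rho x (rho y (rho z (rho t v))).
Proof. exact: etrans (rhoM _ _ _) (rhoM3 _ _ _ _). Qed.

Lemma act_comm x y v :
  rho x (rho y v) = rho y (rho x v) -> rho (x * y) v = rho (y * x) v.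
Proof. by move=> xy; apply: etrans (rhoM _ _ _) (etrans xy (esym (rhoM _ _ _))). Qed.

Lemma act_inv x y v : rho x (rho y v) = v -> rho (x * y) v = rho 1 v.
Proof. by move=> xy; apply: etrans (rhoM _ _ _) (etrans xy (esym (rho1 _))). Qed.

Lemma act_qcomm (c : k) x y v : rho x (rho y v) = c *: rho y (rho x v) ->
  rho (x * y) v = rho (c *: (y * x)) v.
Proof.
move=> xy; apply: etrans (rhoM _ _ _) (etrans xy (esym _)).
exact: etrans (rhoZ _ _ _) (congr1 _ (rhoM _ _ _)).
Qed.

Lemma act_scomm (d : nat) x y z v :
    rho x (rho y v) - (-1) ^+ d *: rho y (rho x v) = rho z v ->
  rho (x * y - (-1) ^+ d * (y * x)) v = rho z v.
Proof.
move=> xyz; apply: etrans (rhoB _ _ _) _; rewrite -xyz; congr (_ - _).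
  exact: rhoM.
exact: etrans (rhoS _ _ _) (congr1 _ (rhoM _ _ _)).
Qed.

Lemma act_Serre (c : k) x y v :
    rho x (rho x (rho y v)) - c *: rho x (rho y (rho x v))
      + rho y (rho x (rho x v)) = 0 ->
  rho (x ^+ 2 * y - c *: (x * y * x) + y * x ^+ 2) v = rho 0 v.
Proof.
move=> xy; rewrite rho0 -xy; apply: etrans (rhoD _ _ _) _; congr (_ + _).
  apply: etrans (rhoB _ _ _) _; congr (_ - _).
    exact: etrans (rhoM _ _ _) (rhoX2 _ _).
  exact: etrans (rhoZ _ _ _) (congr1 _ (rhoM3 _ _ _ _)).
exact: etrans (rhoM _ _ _) (congr1 _ (rhoX2 _ _)).
Qed.

Lemma act_Serre4 (c : k) (h i j : A) (fh fi fj : Om -> Om) v :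
    rho h =1 fh -> rho i =1 fi -> rho j =1 fj ->
    fh (fi (fj (fi v))) + fi (fh (fi (fj v))) + fj (fi (fh (fi v)))
      + fi (fj (fi (fh v))) - c *: fi (fh (fj (fi v))) = 0 ->
  rho (h * i * j * i + i * h * i * j + j * i * h * i + i * j * i * h
       - c *: (i * h * j * i)) v = rho 0 v.
Proof.
move=> hE iE jE hij; rewrite rho0 -hij -!hE -!iE -!jE.
apply: etrans (rhoB _ _ _) _; congr (_ - _).
  do 3![apply: etrans (rhoD _ _ _) _; congr (_ + _); last exact: rhoM4].
  exact: rhoM4.
exact: etrans (rhoZ _ _ _) (congr1 _ (rhoM4 _ _ _ _ _)).
Qed.

Lemma act_sandwich (d : nat) s x v :
    rho s (rho x (rho s v)) = (-1) ^+ d *: rho x v ->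
  rho (s * x * s) v = rho ((-1) ^+ d * x) v.
Proof.
by move=> sx; apply: etrans (rhoM3 _ _ _ _) (etrans sx (esym (rhoS _ _ _))).
Qed.

Lemma calK_act (j : J) v : rho (calK k g j) v =
  diag_op (fun b => K_val q (lo j) b / K_val q (hi j) b) v.
Proof.
case: g rho rhoM rhoG => rho' rhoM' rhoG'; rewrite /calK.
  by rewrite rhoM' !rhoG' /= diag_op_comp.
by rewrite rhoG'.
Qed.

Lemma calKinv_act (j : J) v : rho (calKinv k g j) v =
  diag_op (fun b => (K_val q (lo j) b / K_val q (hi j) b)^-1) v.
Proof.
case: g rho rhoM rhoG => rho' rhoM' rhoG'; rewrite /calKinv.
  rewrite rhoM' !rhoG' /= diag_op_comp; apply: eq_diag_op => b.
  by rewrite invf_div.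
by rewrite rhoG'.
Qed.

Lemma parity_val2 b : parity_val b * parity_val b = 1.
Proof. by rewrite /parity_val -expr2 sqrr_sign. Qed.

Lemma parity_opK v : gen_op q (@gSigma m n g) (gen_op q (@gSigma m n g) v) = v.
Proof. by rewrite /= diag_op_comp diag_op1 // => b; apply: parity_val2. Qed.

Lemma Urel_act x y : Urel q x y -> forall v, rho x v = rho y v.
Proof.
case=> [a b|a|a|a j|a j|i j|i j far_ij|i j far_ij|i j adj ev|i j adj ev|i odd_i
       |i odd_i|h i j odd_i ih ji|h i j odd_i ih ji||j|j|a] v.
- by apply: act_comm; rewrite !rhoG; apply: diag_op_comm.
- apply: act_inv; rewrite !rhoG /= diag_op_comp diag_op1 // => c.
  by rewrite mulfV ?cartan_val_neq0.
- apply: act_inv; rewrite !rhoG /= diag_op_comp diag_op1 // => c.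
  by rewrite mulVf ?cartan_val_neq0.
- apply: act_qcomm; rewrite !rhoG; apply: diag_E_op => b; exact: cartan_val_E.
- apply: act_qcomm; rewrite !rhoG; apply: diag_F_op => b; exact: cartan_val_F.
- apply: act_scomm; rewrite !rhoG /=.
  have [<-|ij] := eqVneq i j.
    rewrite rhoZ rhoB calK_act calKinv_act EF_op_diag // FE_op_diag //.
    apply: diag_op_comb => b.
    by rewrite mulnn -raise_lower_commutator // /odd_node; case: (_ == m).
  rewrite rho0 EF_op_neq //.
  have -> : (odd_node i * odd_node j)%N = 0%N.
    by apply/eqP; rewrite muln_eq0 !eqb0 -negb_and; apply: contra ij => /andP[
      /eqP im /eqP jm]; apply/eqP/val_inj/succn_inj; rewrite im jm.
  by rewrite scale1r subrr.
- by apply: act_comm; rewrite !rhoG; apply: E_op_far.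
- by apply: act_comm; rewrite !rhoG; apply: F_op_far.
- by apply: act_Serre; rewrite !rhoG; apply: E_op_Serre.
- by apply: act_Serre; rewrite !rhoG; apply: F_op_Serre.
- rewrite rhoX2 !rhoG rho0; apply: E_op_nilp => //.
  by rewrite /= (eqP odd_i).
- rewrite rhoX2 !rhoG rho0; apply: F_op_nilp => //.
  by rewrite /= (eqP odd_i).
- have GE l : rho (fgen k (gE l)) =1 E_op q l by move=> w; apply: rhoG.
  by apply: (act_Serre4 (GE h) (GE i) (GE j)); apply: E_op_Serre4.
- have GF l : rho (fgen k (gF l)) =1 F_op q l by move=> w; apply: rhoG.
  by apply: (act_Serre4 (GF h) (GF i) (GF j)); apply: F_op_Serre4.
- apply: etrans (rhoX2 _ _) (etrans _ (esym (rho1 v))).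
  by rewrite !rhoG; apply: parity_opK.
- apply: act_sandwich; rewrite !rhoG -[in RHS](parity_opK v).
  by apply: diag_E_op => b; apply: parity_E.
- apply: act_sandwich; rewrite !rhoG -[in RHS](parity_opK v).
  by apply: diag_F_op => b; apply: parity_F.
apply: etrans (rhoM3 _ _ _ _) _; rewrite !rhoG -[in RHS](parity_opK v).
exact: diag_op_comm.
Qed.

End Generators.

End UqModule.

(** * Subspaces spanned by monomials *)

Section MonomialSubspaces.
Context (k : fieldType) (q : k) (q_neq0 : q != 0) (q2_neq1 : q ^+ 2 != 1).
Context (m n : nat).
Notation I := 'I_(m + n).
Notation J := 'I_(m + n).-1.
Notation Om := (Omega k m n).
Implicit Types (b : mono m n) (P : pred (mono m n)).

Definition supp_in P : {pred Om} := [pred u : Om | all P (msupp u)].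

Lemma supp_inP P (u : Om) : reflect (forall b, u@_b != 0 -> P b) (u \in supp_in P).
Proof.
apply: (iffP allP) => Pu b; first by rewrite mcoeff_neq0; apply: Pu.
by rewrite -mcoeff_neq0; apply: Pu.
Qed.

Lemma supp_in_submod P : submod_closed (supp_in P).
Proof.
split=> [|c u v /supp_inP Pu /supp_inP Pv]; apply/supp_inP => b.
  by rewrite mcoeff0 eqxx.
rewrite mcoeffD mcoeffZ; have [u0|/Pu //] := eqVneq u@_b 0.
by rewrite u0 mulr0 add0r; apply: Pv.
Qed.

Lemma supp_in0 P : 0 \in supp_in P.
Proof. by have [] := supp_in_submod P. Qed.

Lemma supp_inD P u v : u \in supp_in P -> v \in supp_in P -> u + v \in supp_in P.
Proof.
by move=> Pu Pv; have [_ /(_ 1 u v Pu Pv)] := supp_in_submod P; rewrite scale1r.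
Qed.

Lemma supp_inZ P (c : k) u : u \in supp_in P -> c *: u \in supp_in P.
Proof.
move=> Pu; have [P0 /(_ c u 0 Pu P0)] := supp_in_submod P.
by rewrite addr0.
Qed.

Lemma supp_in_mono P b : P b -> x_mono k b \in supp_in P.
Proof.
move=> Pb; apply/supp_inP => c; rewrite mcoeffU.
by case: (eqVneq b c) => [<- //|]; rewrite mulr0n eqxx.
Qed.

Lemma Omega_decomp (u : Om) : u = \sum_(b <- msupp u) u@_b *: x_mono k b.
Proof. by rewrite {1}[u]monalgE; apply: eq_bigr => b _; apply: malgUZ. Qed.

Lemma supp_in_stable P (f : {linear Om -> Om}) :
    (forall b, P b -> f (x_mono k b) \in supp_in P) ->
  forall u, u \in supp_in P -> f u \in supp_in P.
Proof.
move=> Pf u /allP; rewrite {2}(Omega_decomp u) linear_sum.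
elim: (enum_fset (msupp u)) => [|b s IHs] Ps.
  by rewrite big_nil supp_in0.
rewrite big_cons; apply: supp_inD.
  by rewrite linearZ; apply/supp_inZ/Pf/Ps; rewrite inE eqxx.
by apply: IHs => c cs; apply: Ps; rewrite inE cs orbT.
Qed.

Lemma E_opU (j : J) b : E_op q j (x_mono k b) =
  shift_coef q b (lo j) (hi j) *: x_mono k (shift b (lo j) (hi j)).
Proof. by rewrite E_opE // raise_lowerU // lo_neq_hi. Qed.

Lemma F_opU (j : J) b : F_op q j (x_mono k b) =
  shift_coef q b (hi j) (lo j) *: x_mono k (shift b (hi j) (lo j)).
Proof. by rewrite F_opE // raise_lowerU // eq_sym lo_neq_hi. Qed.

Definition move_closed P : Prop := forall (j : J) b, P b ->
  (shift_coef q b (lo j) (hi j) != 0 -> P (shift b (lo j) (hi j))) /\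
  (shift_coef q b (hi j) (lo j) != 0 -> P (shift b (hi j) (lo j))).

Lemma supp_in_gen P g (x : gen m n g) : move_closed P ->
  forall u, u \in supp_in P -> gen_op q x u \in supp_in P.
Proof.
move=> Pmv; apply: supp_in_stable => b Pb; case: x => [j|j|a|a|] /=.
- rewrite E_opU; have [->|nz] := eqVneq (shift_coef q b (lo j) (hi j)) 0.
    by rewrite scale0r supp_in0.
  by apply/supp_inZ/supp_in_mono; apply: (Pmv j b Pb).1.
- rewrite F_opU; have [->|nz] := eqVneq (shift_coef q b (hi j) (lo j)) 0.
    by rewrite scale0r supp_in0.
  by apply/supp_inZ/supp_in_mono; apply: (Pmv j b Pb).2.
- by rewrite diag_opU; apply/supp_inZ/supp_in_mono.
- by rewrite diag_opU; apply/supp_inZ/supp_in_mono.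
by rewrite diag_opU; apply/supp_inZ/supp_in_mono.
Qed.

Lemma shift_deg b (i j : I) : i != j -> shift_coef q b i j != 0 ->
  mono_deg (shift b i j) = mono_deg b.
Proof.
move=> ij nz; rewrite !mono_degE; apply/eqP; rewrite -eqz_nat.
rewrite !(big_morph Posz PoszD (erefl _)).
under eq_bigr do rewrite (expo_shift _ ij nz).
have delta (h : I) : \sum_(l < m + n) (l == h)%:Z = 1.
  by rewrite (bigD1 h) //= eqxx big1 ?addr0 // => l /negPf->.
by rewrite sumrB big_split /= !delta addrK.
Qed.

(** Induction on the height replaces induction on the weight order. *)
Definition height b : nat := \sum_(i < m + n) i * expo b i.

Lemma height_E b (j : J) : shift_coef q b (lo j) (hi j) != 0 ->
  height b = (height (shift b (lo j) (hi j))).+1.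
Proof.
move=> nz; have ij := lo_neq_hi j; apply/eqP; rewrite /height -eqz_nat -addn1 PoszD.
rewrite !(big_morph Posz PoszD (erefl _)).
under [X in _ == X + _]eq_bigr do rewrite PoszM (expo_shift _ ij nz).
under eq_bigr do rewrite PoszM.
have delta (h : I) : \sum_(l < m + n) (l : nat)%:Z * (l == h)%:Z = (h : nat)%:Z.
  rewrite (bigD1 h) //= eqxx mulr1 big1 ?addr0 // => l /negPf->.
  by rewrite mulr0.
under [X in _ == X + _]eq_bigr do rewrite mulrBr mulrDr.
rewrite sumrB big_split /= !delta /=.
by apply/eqP; rewrite -addn1 PoszD; ring.
Qed.

Lemma shift_inj b b' (i j : I) : i != j ->
    shift_coef q b i j != 0 -> shift_coef q b' i j != 0 ->
  shift b i j = shift b' i j -> b = b'.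
Proof.
move=> ij nz nz' eq_s; apply: mono_ext => l.
have := expo_shift l ij nz; rewrite eq_s (expo_shift l ij nz').
by move/addIr/addIr => [].
Qed.

Lemma E_op_coef (j : J) (u : Om) c : (E_op q j u)@_c =
  \sum_(b <- msupp u) u@_b * shift_coef q b (lo j) (hi j)
     * (shift b (lo j) (hi j) == c)%:R.
Proof.
rewrite {1}(Omega_decomp u) linear_sum (raddf_sum (mcoeff c)).
apply: eq_bigr => b _ /=; rewrite linearZ /= E_opU !mcoeffZ mulrA mcoeffU.
by rewrite mulrA.
Qed.

Lemma E_op_supp (j : J) (u : Om) c : c \in msupp (E_op q j u) ->
  exists b, [/\ b \in msupp u, shift_coef q b (lo j) (hi j) != 0
              & c = shift b (lo j) (hi j)].
Proof.
rewrite -mcoeff_neq0 E_op_coef => nz.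
have /hasP[b bu] : has (fun b => (shift_coef q b (lo j) (hi j) != 0)
                     && (shift b (lo j) (hi j) == c)) (msupp u).
  apply: contraNT nz => /hasPn none; rewrite big_seq big1 // => b /none.
  rewrite negb_and negbK => /orP[/eqP->|/negPf->]; last by rewrite mulr0.
  by rewrite mulr0 mul0r.
by case/andP => nzb /eqP <-; exists b.
Qed.

(** Distinct monomials are moved to distinct ones (shift_inj), so no
    cancellation occurs. *)
Lemma E_op_kernel (j : J) (u : Om) b :
  E_op q j u = 0 -> b \in msupp u -> shift_coef q b (lo j) (hi j) = 0.
Proof.
move=> Eu0 bu; apply/eqP; apply: contraT => nz.
have := E_op_coef j u (shift b (lo j) (hi j)); rewrite Eu0 mcoeff0.
rewrite (bigD1_seq b) ?fset_uniq //= eqxx mulr1 big1 ?addr0 => [/esym/eqP|c cb].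
  by rewrite mulf_eq0 (negPf nz) orbF mcoeff_eq0 bu.
have [->|nzc] := eqVneq (shift_coef q c (lo j) (hi j)) 0.
  by rewrite mulr0 mul0r.
case: eqP => [eq_s|]; last by rewrite mulr0.
by case/eqP: cb; apply: shift_inj eq_s => //; apply: lo_neq_hi.
Qed.

End MonomialSubspaces.

(** * Staircases *)

Section Staircase.
Context (m n : nat).
Notation I := 'I_(m + n).
Notation J := 'I_(m + n).-1.
Context (cap : I -> nat) (cap_gt0 : forall i, (0 < cap i)%N).

Definition staircase (a : I -> nat) : Prop :=
  forall j : J, a (hi j) = 0%N \/ a (lo j) = cap (lo j).

Lemma staircase_tail (a : I -> nat) (i l : I) :
  staircase a -> (i < l)%N -> a i != cap i -> a l = 0%N.
Proof.
move=> st; move Dd: (l - i)%N => d; elim: d l Dd => [|d IHd] l Dd il ai; first lia.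
have lt_l : (l.-1 < (m + n).-1)%N by have := ltn_ord l; lia.
pose j : J := Ordinal lt_l.
have <- : hi j = l by apply: val_inj => /=; lia.
have [//|full] := st j.
have lo_j : lo j = l.-1 :> nat by [].
case: (ltngtP i (lo j)) => lt_i; first 1 last.
- by move: lt_i; rewrite lo_j; lia.
- by move: ai; rewrite (_ : i = lo j) ?full ?eqxx //; apply: val_inj.
have lo0 : a (lo j) = 0%N by apply: IHd => //; rewrite lo_j; lia.
by have := cap_gt0 (lo j); rewrite -full lo0.
Qed.

(** If a i < a' i, then a vanishes beyond i, while a' is full in front of i
    because it is nonzero at i; hence a has the smaller total. *)
Lemma staircase_unique (a a' : I -> nat) :
    staircase a -> staircase a' ->
    (forall i, a i <= cap i)%N -> (forall i, a' i <= cap i)%N ->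
    (\sum_i a i = \sum_i a' i)%N ->
  a =1 a'.
Proof.
have lt_absurd (c c' : I -> nat) i : staircase c -> staircase c' ->
    (forall i, c i <= cap i)%N -> (forall i, c' i <= cap i)%N ->
    (c i < c' i)%N -> (\sum_i c i < \sum_i c' i)%N.
  move=> st st' le le' lt_i; rewrite (bigD1 i) // [X in (_ < X)%N](bigD1 i) //=.
  rewrite -addSn leq_add // leq_sum // => l li.
  case: (ltngtP l i) => [lt_li|lt_il|/val_inj eq_li]; last by rewrite eq_li eqxx in li.
    have [c'l|c'l] := eqVneq (c' l) (cap l); first by rewrite c'l le.
    by move: lt_i; rewrite (staircase_tail st' lt_li c'l).
  rewrite (staircase_tail st lt_il) // neq_ltn (leq_trans lt_i) //.
move=> st st' le le' eq_sum i; case: (ltngtP (a i) (a' i)) => // lt_i.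
  by have := lt_absurd _ _ _ st st' le le' lt_i; rewrite eq_sum ltnn.
by have := lt_absurd _ _ _ st' st le' le lt_i; rewrite eq_sum ltnn.
Qed.

End Staircase.

(** * Highest weight vectors and simplicity *)

Section HighestWeight.
Context (k : fieldType) (q : k) (q_neq0 : q != 0) (q2_neq1 : q ^+ 2 != 1).
Context (m n : nat) (g : gtype).
Notation I := 'I_(m + n).
Notation J := 'I_(m + n).-1.
Notation Om := (Omega k m n).
Implicit Types (b : mono m n).

Context (V : lmodType k) (iota : {linear V -> Om}) (iota_inj : injective iota).
(** The module V stands for the full algebra or for its restricted part, and U for
    the algebra acting on it; W is the span of the monomials in P, the ones of
    degree t in V. *)
Context (U : pzRingType) (pi : free_alg k m n g -> U) (rho : module_on U V).
Context (rho_scal : forall c v, rho (pi (fscal m n g c)) v = c *: v).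
Context (rho_gen : forall (x : gen m n g) v,
  iota (rho (pi (fgen k x)) v) = gen_op q x (iota v)).
Context (rho_stable : forall T : {pred V}, submod_closed T ->
  (forall (x : gen m n g) v, v \in T -> rho (pi (fgen k x)) v \in T) ->
  forall u v, v \in T -> rho u v \in T).

Context (P : pred (mono m n)) (P_closed : move_closed q P).
Context (P_surj : forall b, P b -> exists v, iota v = x_mono k b).

Context (W : {pred V}) (WE : forall v, (v \in W) = (iota v \in supp_in P)).

Lemma span_submod_k : submod_closed W.
Proof.
split=> [|c u v]; rewrite !WE ?linear0 ?supp_in0 // => Pu Pv.
by rewrite linearP; apply: supp_inD => //; apply: supp_inZ.
Qed.

Lemma span_submod : submod_closed (W : {pred mod_of rho}).
Proof.
have stab : forall u v, v \in W -> rho u v \in W.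
  apply: rho_stable; first exact: span_submod_k.
  by move=> x v; rewrite !WE rho_gen; apply: supp_in_gen.
have [P0 PD] := span_submod_k.
split=> // a u v Pu Pv; have := PD 1 _ _ (stab a u Pu) Pv.
by rewrite scale1r.
Qed.

Context (t : nat) (P_deg : forall b, P b -> mono_deg b = t).
Context (cap : I -> nat) (cap_gt0 : forall i, (0 < cap i)%N).
Context (P_cap : forall b i, P b -> (expo b i <= cap i)%N).
Context (P_full : forall b i, P b -> rise q i (expo b i) = 0 -> expo b i = cap i).
Context (P_fall : forall b (i : I), P b -> (0 < expo b i)%N ->
  rise q i (expo b i).-1 != 0).
Context (top : mono m n) (P_top : P top).
Context (top_killed : forall j : J, shift_coef q top (lo j) (hi j) = 0).

Lemma killed_staircase b : P b ->
  (forall j : J, shift_coef q b (lo j) (hi j) = 0) -> staircase cap (expo b).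
Proof.
move=> Pb kb j; have /eqP := kb j; rewrite mulf_eq0 => /orP[|/eqP/(P_full Pb)].
  by left; case: (expo b (hi j)) a => // c; rewrite oner_eq0.
by right.
Qed.

Lemma killed_top b : P b ->
  (forall j : J, shift_coef q b (lo j) (hi j) = 0) -> b = top.
Proof.
move=> Pb kb; apply: mono_ext; apply: (staircase_unique cap_gt0).
- exact: killed_staircase.
- exact: killed_staircase.
- by move=> i; apply: P_cap.
- by move=> i; apply: P_cap.
by rewrite -!mono_degE !P_deg.
Qed.

Context (lam : weight m n) (lamE : forall i, lam i = (expo top i)%:Z).
Context (v0 : V) (v0E : iota v0 = x_mono k top).

Let M : lmodType U := mod_of rho.
Let w0 : M := v0.

Lemma wform_eps (w : weight m n) (i : I) :
  wform w (eps i) = if (i < m)%N then w i else - w i.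
Proof.
rewrite /wform (bigD1 i) //= ffunE eqxx mulr1 big1 ?addr0 // => l /negPf li.
by rewrite ffunE li mulr0 oppr0 if_same.
Qed.

Lemma wformB (w u u' : weight m n) : wform w (u - u') = wform w u - wform w u'.
Proof.
rewrite /wform -sumrB; apply: eq_bigr => i _; rewrite !ffunE.
by case: ifP => _; ring.
Qed.

Lemma cartan_val_top (a : cartan m n g) :
  cartan_val q a top = q ^ wform lam (cartan_wt a).
Proof.
have Keps i : K_val q i top = q ^ wform lam (eps i).
  rewrite K_valE wform_eps lamE /qi; case: ifP => // _.
  by rewrite exprVn -invr_expz.
case: g a => a /=; first exact: Keps.
by rewrite !Keps wformB expfzDr // invr_expz.
Qed.

Lemma top_hw_vector : hw_vector q pi lam w0.
Proof.
split.
- apply/eqP => w00; have := v0E; rewrite (w00 : v0 = 0) linear0 => /esym/eqP.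
  by rewrite monalgU_eq0 oner_eq0.
- move=> j; apply: iota_inj; rewrite [LHS]rho_gen v0E linear0 /= E_opU //.
  by rewrite top_killed scale0r.
move=> a; apply: iota_inj; rewrite [LHS]rho_gen v0E /= diag_opU.
have -> : pi (fscal m n g (q ^ wform lam (cartan_wt a))) *: w0 =
    q ^ wform lam (cartan_wt a) *: v0 by apply: rho_scal.
by rewrite linearZ /= v0E cartan_val_top.
Qed.

(** Every monomial of P lies in the orbit of v0, by induction on the height: some
    E_j moves b to a monomial b' of smaller height unless b = top, and F_j moves
    b' back. *)
Lemma top_generates : generated_by (W : {pred M}) w0.
Proof.
pose C (u : V) := exists a : U, u = rho a v0.
have CD u v : C u -> C v -> C (u + v).
  by move=> [a ->] [b ->]; exists (a + b); rewrite actDl.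
have CZ c u : C u -> C (c *: u).
  by move=> [a ->]; exists (pi (fscal m n g c) * a); rewrite -actA rho_scal.
have C0 : C 0 by exists 0; rewrite module0l.
have Cmono : forall N b, (height b < N)%N -> P b ->
    exists2 v, iota v = x_mono k b & C v.
  elim=> // N IHN b; rewrite ltnS => bN Pb.
  have [v vE] := P_surj Pb; exists v => //.
  have [killed | [j nz]] :
      (forall j : J, shift_coef q b (lo j) (hi j) = 0) \/
      exists j : J, shift_coef q b (lo j) (hi j) != 0.
    case: (altP (@forallP _ (fun j : J => shift_coef q b (lo j) (hi j) == 0))).
      by left=> j; apply/eqP.
    by move=> /forallPn; right.
  - have b_top := killed_top Pb killed; exists 1; rewrite act1.
    by apply: iota_inj; rewrite vE v0E b_top.
  set b' := shift b (lo j) (hi j).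
  have Pb' : P b' by apply: (P_closed j Pb).1.
  have [|w wE Cw] := IHN b' _ Pb'.
    by move: bN; rewrite (height_E nz).
  have ne := lo_neq_hi j; have ne' : hi j != lo j by rewrite eq_sym.
  have hi_b : (0 < expo b (hi j))%N.
    by move: nz; rewrite /shift_coef; case: posnP; rewrite ?mul0r ?eqxx.
  have lo' : expo b' (lo j) = (expo b (lo j)).+1.
    apply/eqP; rewrite -eqz_nat (expo_shift _ ne nz) eqxx (negPf ne).
    by rewrite subr0 -PoszD addn1.
  have hi' : expo b' (hi j) = (expo b (hi j)).-1.
    apply/eqP; rewrite -eqz_nat (expo_shift _ ne nz) eqxx (negPf ne') addr0.
    by clear -hi_b; lia.
  have nz' : shift_coef q b' (hi j) (lo j) != 0.
    by rewrite /shift_coef lo' hi' /= mul1r P_fall.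
  have back : shift b' (hi j) (lo j) = b.
    apply: mono_ext => l; apply/eqP; rewrite -eqz_nat (expo_shift _ ne' nz').
    rewrite (expo_shift _ ne nz); apply/eqP; ring.
  suff -> : v = (shift_coef q b' (hi j) (lo j))^-1 *: rho (pi (fgen k (gF j))) w.
    by apply: CZ; have [a ->] := Cw; exists (pi (fgen k (gF j)) * a); rewrite actA.
  apply: iota_inj; rewrite linearZ /= rho_gen wE /= F_opU // back vE.
  by rewrite scalerA mulVf // scale1r.
(* Sums of monomials of P; V only contains them through iota. *)
have Csum : forall (s : seq (mono m n)) (c : mono m n -> k) v, all P s ->
    iota v = \sum_(b <- s) c b *: x_mono k b -> C v.
  elim=> [|b s IHs] c v /=.
    by move=> _; rewrite big_nil -(linear0 iota) => /iota_inj->.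
  case/andP=> Pb Ps; rewrite big_cons => vE.
  have [w wE Cw] := Cmono _ b (ltnSn _) Pb.
  have -> : v = c b *: w + (v - c b *: w) by rewrite addrC subrK.
  apply: CD; first exact: CZ.
  apply: IHs Ps _; last by rewrite linearB linearZ /= vE wE addrC addKr.
move=> u; split=> [| [a ->]].
  by rewrite WE => Pu; apply: Csum Pu (Omega_decomp _).
have [W0 WD] := span_submod; rewrite -[a *: _]addr0; apply: WD => //.
by rewrite WE v0E supp_in_mono.
Qed.

(** Applying the E_j as long as possible leads from any nonzero vector to a
    nonzero vector killed by all of them, which is a multiple of v0. *)
Lemma span_simple : simple_submod (W : {pred M}).
Proof.
split; first exact: span_submod.
  exists w0; first by rewrite WE v0E supp_in_mono.
  by have [] := top_hw_vector.
move=> T [T0 TD] TW.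
have TZ (a : U) (u : M) : u \in T -> a *: u \in T.
  by move=> Tu; rewrite -[_ *: u]addr0; apply: TD.
have climb : forall N (u : M), u \in T -> u != 0 ->
    (forall b, b \in msupp (iota u) -> (height b < N)%N) -> w0 \in T.
  elim=> [|N IHN] u Tu u0 uN.
    case/eqP: u0; apply: iota_inj; apply: etrans (esym (linear0 iota)).
    apply/malgP => b; rewrite mcoeff0; apply/eqP; rewrite mcoeff_eq0.
    by apply/negP => /uN; rewrite ltn0.
  have [|] := altP (@forallP _ (fun j : J => rho (pi (fgen k (gE j))) u == 0)).
    move=> killed; have only b : b \in msupp (iota u) -> b = top.
      move=> bu; apply: killed_top; first by move: (TW u Tu); rewrite WE => /allP; apply.
      move=> j; apply: (E_op_kernel q_neq0 q2_neq1 _ bu).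
      by have := rho_gen (gE j) u; rewrite (eqP (killed j)) linear0.
    set c := (iota u)@_top.
    have uE : iota u = c *: x_mono k top.
      apply/malgP => b; rewrite mcoeffZ mcoeffU.
      have [<-|tb] := eqVneq top b; first by rewrite mulr1.
      rewrite mulr0; apply/eqP; rewrite mcoeff_eq0; apply/negP => /only bt.
      by rewrite bt eqxx in tb.
    have c0 : c != 0.
      by apply: contra_neq u0 => c0; apply: iota_inj; rewrite uE c0 scale0r linear0.
    have iota_cu : iota (c^-1 *: (u : V)) = iota v0.
      by rewrite v0E linearZ /= uE; apply: scalerK.
    have -> : w0 = pi (fscal m n g c^-1) *: u; last exact: TZ.
    exact: etrans (esym (iota_inj iota_cu)) (esym (rho_scal _ _)).
  case/forallPn=> j Ej; apply: (IHN (pi (fgen k (gE j)) *: u)) => //.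
    exact: TZ.
  move=> b; rewrite [iota _]rho_gen => /(E_op_supp q_neq0 q2_neq1)[c [cu nz ->]].
  by have := uN c cu; rewrite (height_E nz).
have [[w Tw w_neq0] | none] := pselect (exists2 u, u \in T & u != 0); last first.
  left=> u; rewrite inE; apply/idP/eqP => [Tu | -> //].
  by apply/eqP; apply: contraT => u0; case: none; exists u.
right=> u; apply/idP/idP => [/TW //|/top_generates[a ->]]; apply: TZ.
apply: (climb (\sum_(b <- msupp (iota w)) (height b).+1)%N w) => // b bw.
by rewrite (big_rem b) //= addSn ltnS leq_addr.
Qed.

Lemma span_simple_hw : simple_hw q pi lam (W : {pred M}) w0.
Proof.
split; [exact: top_hw_vector | exact: top_generates | exact: span_simple].
Qed.

End HighestWeight.

(** * The modules over the quantum superalgebra and its restricted quotient *)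

Section Modules.
Context (k : fieldType) (q : k) (q_neq0 : q != 0) (q2_neq1 : q ^+ 2 != 1).
Context (m n : nat) (g : gtype).
Notation I := 'I_(m + n).
Notation J := 'I_(m + n).-1.
Notation Om := (Omega k m n).
Implicit Types (b : mono m n).

Context (V : lmodType k) (iota : {linear V -> Om}) (iota_inj : injective iota).
Context (op : gen m n g -> {linear V -> V}).
Context (iota_op : forall x v, iota (op x v) = gen_op q x (iota v)).

Lemma Urel_free_module x y : Urel q x y ->
  forall v, free_module op x v = free_module op y v.
Proof.
move=> xy v; apply: iota_inj.
rewrite !(free_module_intertwine iota_op).
have rhoM (a b : free_alg k m n g) u : free_module (@gen_op k q m n g) (a * b) u =
    free_module (@gen_op k q m n g) a (free_module (@gen_op k q m n g) b u).
  exact: esym (actA _ _ _ _).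
apply: (Urel_act q_neq0 q2_neq1 rhoM _ _ _ _ xy).
- by move=> a b u; apply: actDl.
- exact: act1.
- by move=> c a u; apply: free_moduleZ.
- exact: free_module_gen.
Qed.

Definition Uq_module : module_on (Uq q m n g) V := quot_module Urel_free_module.

Lemma Uq_moduleE x v : Uq_module (piU q x) v = free_module op x v.
Proof. exact: quot_moduleE. Qed.

Lemma Uq_module_gen (x : gen m n g) v : Uq_module (piU q (fgen k x)) v = op x v.
Proof. exact: etrans (Uq_moduleE _ _) (free_module_gen _ _ _). Qed.

Lemma Uq_module_scal c v : Uq_module (piU q (fscal m n g c)) v = c *: v.
Proof. exact: etrans (Uq_moduleE _ _) (free_module_scal _ _ _). Qed.

Lemma Uq_module_stable (T : {pred V}) : submod_closed T ->
    (forall (x : gen m n g) v, v \in T -> op x v \in T) ->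
  forall u v, v \in T -> Uq_module u v \in T.
Proof. by move=> clT Tgen u v Tv; apply: (free_module_stable clT Tgen). Qed.

Context (l : nat).
Context (op_ul : forall x y, urel l x y ->
  forall v, Uq_module x v = Uq_module y v).

Definition uq_module : module_on (uq q m n g l) V := quot_module op_ul.

Lemma uq_moduleE x v : uq_module (piu q l x) v = Uq_module (piU q x) v.
Proof. exact: quot_moduleE. Qed.

Lemma uq_module_gen (x : gen m n g) v : uq_module (piu q l (fgen k x)) v = op x v.
Proof. exact: etrans (uq_moduleE _ _) (Uq_module_gen _ _). Qed.

Lemma uq_module_scal c v : uq_module (piu q l (fscal m n g c)) v = c *: v.
Proof. exact: etrans (uq_moduleE _ _) (Uq_module_scal _ _). Qed.

Lemma uq_module_stable (T : {pred V}) : submod_closed T ->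
    (forall (x : gen m n g) v, v \in T -> op x v \in T) ->
  forall u v, v \in T -> uq_module u v \in T.
Proof. by move=> clT Tgen u v Tv; apply: (Uq_module_stable clT Tgen). Qed.

End Modules.

Lemma module_exp (A : pzRingType) (V : zmodType) (rho : module_on A V) a r v :
  rho (a ^+ r) v = iter r (rho a) v.
Proof.
elim: r => [|r IHr]; first by rewrite act1.
by rewrite exprS -actA IHr.
Qed.

Section RestrictedOperators.
Context (k : fieldType) (q : k) (q_neq0 : q != 0) (q2_neq1 : q ^+ 2 != 1).
Context (m n : nat) (g : gtype) (l : nat).
Context (l_char : is_qchar q l) (l_gt2 : (2 < l)%N).
Notation I := 'I_(m + n).
Notation J := 'I_(m + n).-1.
Notation Om := (Omega k m n).
Notation Om1 := (Omega1 k m n l).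
Implicit Types (b : mono m n).

Lemma qnum_char : qnum q l = 0.
Proof. by case: l l_char l_gt2 => // l' []. Qed.

Lemma qnum_lt s : (0 < s < l)%N -> qnum q s != 0.
Proof. by case: l l_char l_gt2 => // l' [_ H] _; apply: H. Qed.

Lemma q_2l : q ^+ (2 * l) = 1.
Proof.
have := qnum_char; rewrite /qnum => /eqP; rewrite mulf_eq0 invr_eq0.
rewrite (negPf (q_subV_neq0 q_neq0 q2_neq1)) orbF subr_eq0 => /eqP ql.
by rewrite mul2n -addnn exprD {2}ql divff // expf_neq0.
Qed.

Definition small b : bool := [forall i, b.1 i <= l.-1]%N.

Lemma smallP b :
  reflect (forall i : I, (i < m)%N -> (expo b i <= l.-1)%N) (small b).
Proof.
apply: (iffP forallP) => bl i.
  by rewrite /expo; case: split_ordP => // i0 _ _; apply: bl.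
by have := bl (lshift n i); rewrite /expo split_lshift /= => ->.
Qed.

(** Raising a full even site has coefficient [l] = 0. *)
Lemma small_shift b (i j : I) : i != j -> shift_coef q b i j != 0 ->
  small b -> small (shift b i j).
Proof.
move=> ij nz /smallP bl; apply/smallP => h hm.
have := expo_shift h ij nz; have := bl h hm.
have [hi|_] := eqVneq h i; last by case: (h == j); clear; lia.
rewrite -hi in ij nz *; rewrite (negPf ij) => le_h eq_h.
have ne : expo b h <> l.-1.
  move=> eq_l; move/eqP: nz; apply; rewrite /shift_coef /rise hm eq_l.
  by rewrite prednK ?qnum_char ?mulr0 // ltnW // ltnW.
by clear -ne le_h eq_h l_gt2; lia.
Qed.

Lemma small_closed : move_closed q small.
Proof.
move=> j b bs; have ne := lo_neq_hi j.
by split=> nz; apply: small_shift => //; rewrite eq_sym.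
Qed.

Lemma restricted_gen (x : gen m n g) u :
  u \in restricted l -> gen_op q x u \in restricted l.
Proof. exact: (supp_in_gen q_neq0 q2_neq1 _ small_closed). Qed.

Definition Omega1_op (x : gen m n g) (v : Om1) : Om1 :=
  MkOmega1 (restricted_gen x (valP v)).

Lemma Omega1_op_linear x : linear (Omega1_op x).
Proof.
move=> c u v; apply: val_inj.
by rewrite linearP /= linearP.
Qed.

HB.instance Definition _ x :=
  GRing.isLinear.Build k Om1 Om1 *:%R (Omega1_op x) (Omega1_op_linear x).

Lemma iter_Omega1_op x r (v : Om1) :
  val (iter r (Omega1_op x) v) = iter r (gen_op q x) (val v).
Proof. by elim: r => //= r ->. Qed.

(** After r moves every surviving monomial has exponent at least r at i, while a
    restricted one has exponent at most l - 1. *)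
Lemma iter_move0 (f : {linear Om -> Om}) (i j : I) : i != j -> (i < m)%N ->
    (forall b, f (x_mono k b) = shift_coef q b i j *: x_mono k (shift b i j)) ->
  forall u, u \in restricted l -> iter l f u = 0.
Proof.
move=> ij im fU u u_res.
pose Q r b := small b && (r <= expo b i)%N.
have step r w : w \in supp_in (Q r) -> f w \in supp_in (Q r.+1).
  move=> /allP Qw; rewrite [w]Omega_decomp linear_sum.
  move: Qw; elim: (enum_fset (msupp w)) => [|b s IHs] Qs.
    by rewrite big_nil supp_in0.
  rewrite big_cons; apply: supp_inD; last first.
    by apply: IHs => c cs; apply: Qs; rewrite inE cs orbT.
  rewrite linearZ; apply: supp_inZ; rewrite fU.
  have [->|nz] := eqVneq (shift_coef q b i j) 0; first by rewrite scale0r supp_in0.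
  have /andP[bs br] : Q r b by apply: Qs; rewrite inE eqxx.
  apply/supp_inZ/supp_in_mono; rewrite /Q small_shift //=.
  rewrite -lez_nat (expo_shift _ ij nz) eqxx (negPf ij) subr0 -PoszD addn1.
  by rewrite lez_nat ltnS.
have chain r : iter r f u \in supp_in (Q r).
  elim: r => [|r IHr]; last exact: step.
  by apply/allP => b bu; rewrite /Q leq0n andbT; move/allP: u_res; apply.
apply/malgP => b; rewrite mcoeff0; apply/eqP; rewrite mcoeff_eq0; apply/negP => bu.
have /andP[/smallP/(_ i im) small_b] : Q l b by move/allP: (chain l); apply.
by rewrite leqNgt (leq_ltn_trans small_b) // prednK // ltnW // ltnW.
Qed.

Lemma iter_nilp (f : {linear Om -> Om}) (u : Om) :
  (forall w, f (f w) = 0) -> iter l f u = 0.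
Proof.
move=> ff; rewrite -(subnK (ltnW l_gt2)) iterD /= ff.
by elim: (l - 2)%N => //= r ->; rewrite linear0.
Qed.

Lemma cartan_val_2l (a : cartan m n g) b : cartan_val q a b ^+ (2 * l) = 1.
Proof.
have K2l i : K_val q i b ^+ (2 * l) = 1.
  rewrite K_valE -exprM mulnC exprM /qi.
  by case: ifP => _; rewrite ?exprVn q_2l expr1n ?invr1.
by case: g a => a; rewrite /= ?exprMn ?exprVn !K2l ?invr1 ?mulr1.
Qed.

Lemma iter_diag r (c : mono m n -> k) (u : Om) :
  iter r (diag_op c) u = diag_op (fun b => c b ^+ r) u.
Proof.
elim: r => [|r IHr] /=; first by rewrite diag_op1.
by rewrite IHr diag_op_comp; apply: eq_diag_op => b; rewrite exprS.
Qed.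

Definition Omega1_incl : {linear Om1 -> Om} := \val.

Lemma Omega1_incl_inj : injective Omega1_incl. Proof. exact: val_inj. Qed.

Lemma Omega1_incl_op x v :
  Omega1_incl (Omega1_op x v) = gen_op q x (Omega1_incl v).
Proof. by []. Qed.

Definition Omega1_Uq_module : module_on (Uq q m n g) Om1 :=
  Uq_module q_neq0 q2_neq1 Omega1_incl_inj Omega1_incl_op.

Lemma urel_Omega1 x y : urel l x y -> forall v, Omega1_Uq_module x v = Omega1_Uq_module y v.
Proof.
have pow r (z : gen m n g) v : val (Omega1_Uq_module (piU q (fgen k z) ^+ r) v) =
    iter r (gen_op q z) (val v).
  rewrite module_exp -iter_Omega1_op; congr val.
  by elim: r => //= r ->; exact: (Uq_module_gen q_neq0 q2_neq1 Omega1_incl_inj Omega1_incl_op z).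
have z0 v : val (Omega1_Uq_module 0 v) = 0 by rewrite module0l linear0.
have one v : val (Omega1_Uq_module 1 v) = val v by rewrite act1.
case=> [i odd_i|i odd_i|i odd_i|i odd_i|a] v; apply: val_inj;
  rewrite pow ?z0 ?one /=.
- have [im|mi] := ltnP (lo i) m.
    apply: (iter_move0 (lo_neq_hi i) im _ (valP v)) => b; exact: E_opU.
  by apply: iter_nilp => w; apply: E_op_nilp => //; apply: leq_trans mi (leqnSn _).
- have [im|mi] := ltnP (hi i) m.
    have ne : hi i != lo i by rewrite eq_sym lo_neq_hi.
    apply: (iter_move0 ne im _ (valP v)) => b; exact: F_opU.
  by apply: iter_nilp => w; apply: F_op_nilp.
- by apply: E_op_nilp => //; rewrite /= (eqP odd_i).
- by apply: F_op_nilp => //; rewrite /= (eqP odd_i).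
rewrite iter_diag; apply: diag_op1 => b; exact: cartan_val_2l.
Qed.

End RestrictedOperators.

(** * Highest weight monomials *)

Section TopMonomials.
Context (m n : nat).
Notation I := 'I_(m + n).
Notation J := 'I_(m + n).-1.

Definition top_mono (a : nat -> nat) (p : nat) : mono m n :=
  ([ffun i : 'I_m => a i], [ffun i : 'I_n => (i < p)%N]).

Lemma expo_top a p (i : I) :
  expo (top_mono a p) i = if (i < m)%N then a i else (i - m < p)%N.
Proof.
rewrite /expo; case: split_ordP => i0 -> /=; rewrite ffunE //.
by rewrite addKn.
Qed.

Lemma sum_lt_ord p : (p <= n)%N -> (\sum_(i < n) (i < p) = p)%N.
Proof.
suff H r : (\sum_(i < r) (i < p) = minn r p)%N by rewrite H => /minn_idPr.
elim: r => [|r IHr]; first by rewrite big_ord0 min0n.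
by rewrite big_ord_recr /= IHr; case: (ltnP r p); lia.
Qed.

Lemma top_deg a p : (p <= n)%N ->
  mono_deg (top_mono a p) = (\sum_(i < m) a i + p)%N.
Proof.
move=> pn; rewrite /mono_deg; congr (_ + _)%N.
  by apply: eq_bigr => i _; rewrite ffunE.
by rewrite -[RHS](sum_lt_ord pn); apply: eq_bigr => i _; rewrite ffunE.
Qed.

Lemma sum_step (L s r : nat) : (r < m)%N ->
  (\sum_(j < m) (if j < r then L else if j == r :> nat then s else 0) = r * L + s)%N.
Proof.
move=> rm; suff H h : (\sum_(j < h) (if j < r then L else
    if j == r :> nat then s else 0) = minn h r * L + (r < h) * s)%N.
  by rewrite H rm (minn_idPr (ltnW rm)) mul1n.
elim: h => [|h IHh]; first by rewrite big_ord0 min0n.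
rewrite big_ord_recr /= IHh; case: (ltngtP h r) => hr.
- have -> : minn h.+1 r = h.+1 by lia.
  have -> : (r < h.+1)%N = false by lia.
  by rewrite mulSn; lia.
- have -> : minn h.+1 r = r by lia.
  have -> : (r < h.+1)%N = true by lia.
  by rewrite addn0.
have -> : minn h.+1 r = h by lia.
have -> : (r < h.+1)%N = true by lia.
by lia.
Qed.

Lemma omega_mulrn r c (i : I) : (omega m n r *+ c) i = ((i < r)%N * c)%N%:Z.
Proof. by rewrite ffunMnE ffunE PoszM -mulr_natr natz. Qed.

Context (k : fieldType) (q : k).

(** The hypotheses say that an even site in front of a nonempty site cannot be
    raised; among the odd sites, the first p are occupied. *)
Lemma top_killed a p (j : J) :
    ((j.+1 < m)%N -> (0 < a j.+1)%N -> qnum q (a j).+1 = 0) ->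
    (j.+1 = m -> (0 < p)%N -> qnum q (a j).+1 = 0) ->
  shift_coef q (top_mono a p) (lo j) (hi j) = 0.
Proof.
move=> a_even a_odd; rewrite /shift_coef !expo_top /rise /=.
case: (ltngtP j.+1 m) => jm.
- by case: posnP => [_|/(a_even jm)->]; rewrite ?mul0r ?mulr0.
- case: (ltnP (j.+1 - m) p) => jp; last by rewrite mul0r.
  by rewrite (_ : (j - m < p)%N) ?mulr0 //; lia.
rewrite jm subnn; case: (posnP p) => [_|/(a_odd jm)->]; last by rewrite mulr0.
by rewrite mul0r.
Qed.

End TopMonomials.

(** * The homogeneous components *)

Section OmegaChar0.
Context (k : fieldType) (q : k) (q_neq0 : q != 0) (q2_neq1 : q ^+ 2 != 1).
Context (m n : nat) (g : gtype).
Notation Om := (Omega k m n).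
Notation I := 'I_(m + n).

Let idO : {linear Om -> Om} := idfun.
Let idO_inj : injective idO. Proof. by []. Qed.
Let idO_op (x : gen m n g) (v : Om) : idO (gen_op q x v) = gen_op q x (idO v).
Proof. by []. Qed.

Definition Omega_module : module_on (Uq q m n g) Om :=
  Uq_module q_neq0 q2_neq1 idO_inj idO_op.

Lemma Omega_module_gen (x : gen m n g) v :
  Omega_module (piU q (fgen k x)) v = gen_op q x v.
Proof. exact: Uq_module_gen. Qed.

Lemma Omega_acts : acts_by q (piU q) id Omega_module.
Proof.
split=> [c v|j v|j v|a v|v]; first exact: Uq_module_scal.
- exact: Omega_module_gen.
- exact: Omega_module_gen.
- by rewrite K_opE; apply: Omega_module_gen.
exact: Omega_module_gen.
Qed.

Definition of_deg (t : nat) : pred (mono m n) := fun b => mono_deg b == t.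

Lemma of_deg_closed t : move_closed q (of_deg t).
Proof.
move=> j b /eqP bt; have ne := lo_neq_hi j.
split=> nz; rewrite /of_deg (shift_deg _ nz) ?bt //.
by rewrite eq_sym.
Qed.

Lemma Omega_module_stable (T : {pred Om}) : submod_closed T ->
    (forall (x : gen m n g) v, v \in T -> Omega_module (piU q (fgen k x)) v \in T) ->
  forall u v, v \in T -> Omega_module u v \in T.
Proof.
move=> clT Tgen; apply: Uq_module_stable => // x v Tv.
by rewrite -Omega_module_gen; apply: Tgen.
Qed.

Lemma homog_submod t : submod_closed (homog k m n t : {pred mod_of Omega_module}).
Proof.
exact: (span_submod q_neq0 q2_neq1 (iota := idO) Omega_module_gen
  Omega_module_stable (@of_deg_closed t)).
Qed.

Lemma expo_le_deg b (i : I) : (expo b i <= mono_deg b)%N.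
Proof. by rewrite mono_degE (bigD1 i) //= leq_addr. Qed.

Lemma homog_simple_hw t : is_qchar q 0 -> (0 < m)%N ->
  simple_hw q (piU q) (omega m n 1 *+ t)
    (homog k m n t : {pred mod_of Omega_module})
    (x_vec k m n (fun j => if j == 0%N then t else 0%N) 0 : mod_of Omega_module).
Proof.
move=> char0 m0.
set a := fun j => _.
have sum_a : (\sum_(j < m) a j = t)%N.
  by case: (m) m0 => // m' _; rewrite big_ord_recl big1 /= ?addn0.
have gt0 s : (0 < s)%N -> qnum q s != 0 by apply: char0.
(* Even sites are never full: t + 1 exceeds every exponent of degree t. *)
pose cap (i : I) := if (i < m)%N then t.+1 else 1%N.
have cap_gt0 i : (0 < cap i)%N by rewrite /cap; case: ifP.
have P_deg b : of_deg t b -> mono_deg b = t by move/eqP.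
have P_cap b i : of_deg t b -> (expo b i <= cap i)%N.
  move=> /eqP bt; rewrite /cap; case: ltnP => [_|]; last exact: expo_odd_le1.
  by rewrite leqW // -bt expo_le_deg.
have P_full b i : of_deg t b -> rise q i (expo b i) = 0 -> expo b i = cap i.
  move=> _; rewrite /cap /rise; case: (ltnP i m) => [_ /eqP|/(expo_odd_le1 b)].
    by rewrite (negPf (gt0 _ _)).
  by case: (expo b i) => [|[|]] //= _ /eqP; rewrite oner_eq0.
have P_fall b i : of_deg t b -> (0 < expo b i)%N -> rise q i (expo b i).-1 != 0.
  move=> _; rewrite /rise; case: (ltnP i m) => [_ b0|/(expo_odd_le1 b)].
    by rewrite prednK // gt0.
  by case: (expo b i) => [|[|]] // _ _; rewrite oner_neq0.
have P_top : of_deg t (top_mono m n a 0).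
  by rewrite /of_deg top_deg // sum_a addn0.
apply: (span_simple_hw q_neq0 q2_neq1 (iota := idO) idO_inj _ Omega_module_gen
  Omega_module_stable (@of_deg_closed t) _ _ P_deg cap_gt0 P_cap P_full P_fall P_top).
- exact: Uq_module_scal.
- by move=> b _; exists (x_mono k b).
- by [].
- by move=> j; apply: top_killed.
- move=> i; rewrite omega_mulrn expo_top ltnS leqn0 /a.
  by case: (ltnP i m) => im; case: eqP => i0; rewrite ?mul1n //; lia.
by [].
Qed.

End OmegaChar0.

Section OmegaRestricted.
Context (k : fieldType) (q : k) (q_neq0 : q != 0) (q2_neq1 : q ^+ 2 != 1).
Context (m n : nat) (g : gtype) (l : nat).
Context (l_char : is_qchar q l) (l_gt2 : (2 < l)%N).
Notation Om := (Omega k m n).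
Notation Om1 := (Omega1 k m n l).
Notation I := 'I_(m + n).

Let iota : {linear Om1 -> Om} := Omega1_incl k m n l.
Let iota_inj : injective iota := @Omega1_incl_inj k m n l.
Let op : gen m n g -> {linear Om1 -> Om1} :=
  Omega1_op q_neq0 q2_neq1 l_char l_gt2.
Definition Omega1_module : module_on (uq q m n g l) Om1 :=
  uq_module (urel_Omega1 q_neq0 q2_neq1 l_char l_gt2).

Lemma Omega1_module_op (x : gen m n g) v :
  Omega1_module (piu q l (fgen k x)) v = op x v.
Proof. exact: (uq_module_gen (urel_Omega1 q_neq0 q2_neq1 l_char l_gt2)). Qed.

Lemma Omega1_module_gen (x : gen m n g) v :
  val (Omega1_module (piu q l (fgen k x)) v) = gen_op q x (val v).
Proof. by rewrite Omega1_module_op. Qed.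

Lemma Omega1_module_scal c v : Omega1_module (piu q l (fscal m n g c)) v = c *: v.
Proof. exact: (uq_module_scal (urel_Omega1 q_neq0 q2_neq1 l_char l_gt2)). Qed.

Lemma Omega1_module_stable (T : {pred Om1}) : submod_closed T ->
    (forall (x : gen m n g) v, v \in T ->
      Omega1_module (piu q l (fgen k x)) v \in T) ->
  forall u v, v \in T -> Omega1_module u v \in T.
Proof.
move=> clT Tgen; apply: (uq_module_stable (urel_Omega1 q_neq0 q2_neq1 l_char l_gt2)) => //.
by move=> x v Tv; rewrite -Omega1_module_op; apply: Tgen.
Qed.

Lemma Omega1_acts : acts_by q (piu q l) val Omega1_module.
Proof.
split=> [c v|j v|j v|a v|v]; first exact: Omega1_module_scal.
- exact: Omega1_module_gen.
- exact: Omega1_module_gen.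
- by rewrite K_opE; apply: Omega1_module_gen.
exact: Omega1_module_gen.
Qed.

Lemma homog1_submod t :
  submod_closed (homog1 k m n l t : {pred mod_of Omega1_module}).
Proof.
exact: (span_submod q_neq0 q2_neq1 (iota := iota) Omega1_module_gen
  Omega1_module_stable (of_deg_closed q (t := t))).
Qed.

Definition small_of_deg (t : nat) : pred (mono m n) :=
  fun b => small l b && of_deg t b.

Lemma small_of_deg_closed t : move_closed q (small_of_deg t).
Proof.
move=> j b /andP[bs bt].
have [sE sF] := small_closed l_char l_gt2 j bs.
have [dE dF] := of_deg_closed q j bt.
by split=> nz; apply/andP; split; [exact: sE | exact: dE | exact: sF | exact: dF].
Qed.

(** Both families of highest weight monomials are covered: a fills the even sites
    from the left, and p odd sites are occupied only once all of them are full. *)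
Lemma homog1_simple_hw t (a : nat -> nat) (p : nat) (lam : weight m n) :
    (p <= n)%N -> (forall i, (i < m)%N -> (a i <= l - 1)%N) ->
    (\sum_(i < m) a i + p = t)%N ->
    (forall j, (j.+1 < m)%N -> (0 < a j.+1)%N -> a j = l - 1)%N ->
    (forall j, j.+1 = m -> (0 < p)%N -> a j = l - 1)%N ->
    (forall i : I, lam i = (expo (top_mono m n a p) i)%:Z) ->
  exists2 v : Om1, val v = x_vec k m n a p
    & simple_hw q (piu q l) lam
        (homog1 k m n l t : {pred mod_of Omega1_module}) (v : mod_of Omega1_module).
Proof.
move=> pn a_le a_sum a_even a_odd lamE.
have l1 : (l - 1).+1 = l by lia.
pose cap (i : I) := if (i < m)%N then (l - 1)%N else 1%N.
have top_small : small l (top_mono m n a p).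
  by apply/smallP => i im; rewrite expo_top im -subn1 a_le.
have lift b : small l b -> exists v, iota v = x_mono k b.
  move=> bs; have b_res : x_mono k b \in restricted l by apply: supp_in_mono.
  by exists (MkOmega1 b_res).
have [v vE] := lift _ top_small; exists v; first exact: vE.
have cap_gt0 i : (0 < cap i)%N by rewrite /cap; case: ifP => // _; lia.
have P_deg b : small_of_deg t b -> mono_deg b = t by case/andP => _ /eqP.
have P_cap b i : small_of_deg t b -> (expo b i <= cap i)%N.
  case/andP => /smallP bs _; rewrite /cap subn1.
  by case: ltnP => [|]; [exact: bs | exact: expo_odd_le1].
have P_full b i : small_of_deg t b -> rise q i (expo b i) = 0 -> expo b i = cap i.
  move=> Pb; have := P_cap b i Pb; rewrite /cap /rise.
  case: ifP => im b_le /eqP.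
    apply: contraTeq => b_ne; apply: (qnum_lt l_char l_gt2); clear -b_ne b_le l1; lia.
  by move: b_le; case: (expo b i) => [|[|]] //=; rewrite oner_eq0.
have P_fall b i : small_of_deg t b -> (0 < expo b i)%N ->
    rise q i (expo b i).-1 != 0.
  move=> Pb b0; have := P_cap b i Pb; rewrite /cap /rise.
  case: ifP => im b_le.
    by rewrite prednK // (qnum_lt l_char l_gt2) // b0; clear -b_le l1; lia.
  by move: b_le b0; case: (expo b i) => [|[|]] //=; rewrite oner_eq0.
have P_top : small_of_deg t (top_mono m n a p).
  by rewrite /small_of_deg top_small /of_deg top_deg // a_sum /=.
have q_l := qnum_char l_char l_gt2.
apply: (span_simple_hw q_neq0 q2_neq1 (iota := iota) iota_inj Omega1_module_scal
  Omega1_module_gen Omega1_module_stable (@small_of_deg_closed t) _ _ P_deg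
  cap_gt0 P_cap P_full P_fall P_top _ lamE vE).
- by move=> b /andP[bs _]; apply: lift.
- move=> u; apply/allP/allP => ut b bu.
    by rewrite /small_of_deg [of_deg _ _]ut // andbT; move/allP: (valP u); apply.
  by have /andP[] := ut b bu.
move=> j; apply: top_killed => [jm aj|jm p0].
  by rewrite (a_even _ jm aj) l1.
by rewrite (a_odd _ jm p0) l1.
Qed.

End OmegaRestricted.

Theorem theorem28 (k : closedFieldType) (char0 : [pchar k] =i pred0)
    (q : k) (q_neq0 : q != 0) (q2_neq1 : q ^+ 2 != 1)
    (m n : nat) (m_ge1 : (1 <= m)%N) (g : gtype) :
  (exists rho : module_on (Uq q m n g) (Omega k m n),
    [/\ acts_by q (piU q) id rho,
        forall t : nat, submod_closed (homog k m n t : {pred mod_of rho})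
      & is_qchar q 0 -> forall t : nat,
          let S : {pred mod_of rho} := homog k m n t in
          let lam := omega m n 1 *+ t in
          let v : mod_of rho :=
            x_vec k m n (fun j => if j == 0%N then t else 0%N) 0 in
          simple_hw q (piU q) lam S v
          /\ iso_V q (piU q) lam S])
  /\
  (forall l : nat, is_qchar q l -> (2 < l)%N ->
    exists rho : module_on (uq q m n g l) (Omega1 k m n l),
    [/\ acts_by q (piu q l) val rho,
        forall t : nat, submod_closed (homog1 k m n l t : {pred mod_of rho}),
        forall i ti t : nat, (1 <= i <= m)%N -> (ti <= l - 1)%N ->
          t = ((i - 1) * (l - 1) + ti)%N ->
          let S : {pred mod_of rho} := homog1 k m n l t in
          let lam := omega m n (i - 1) *+ (l - 1 - ti) + omega m n i *+ ti in
          (exists2 v : Omega1 k m n l,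
             val v = x_vec k m n (fun j => if (j < i - 1)%N then (l - 1)%N
                                           else if j == (i - 1)%N then ti
                                           else 0%N) 0
             & simple_hw q (piu q l) lam S (v : mod_of rho))
          /\ iso_V q (piu q l) lam S
      & forall p t : nat, (p <= n)%N -> t = (m * (l - 1) + p)%N ->
          let S : {pred mod_of rho} := homog1 k m n l t in
          let lam := omega m n m *+ (l - 2) + omega m n (m + p) in
          (exists2 v : Omega1 k m n l,
             val v = x_vec k m n (fun=> (l - 1)%N) p
             & simple_hw q (piu q l) lam S (v : mod_of rho))
          /\ iso_V q (piu q l) lam S]).
Proof.
split.
  exists (Omega_module q_neq0 q2_neq1 m n g); split.
  - exact: Omega_acts.
  - exact: homog_submod.
  move=> qchar0 t S lam v.
  have hw : simple_hw q (piU q) lam S v by apply: homog_simple_hw.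
  by split=> //; apply: simple_hw_iso_V hw.
move=> l l_char l_gt2; exists (Omega1_module q_neq0 q2_neq1 m n g l_char l_gt2).
split; [exact: Omega1_acts | exact: homog1_submod | |].
- move=> i ti t /andP[i1 im] til tE S lam.
  set a := fun j : nat => _.
  have pred_i : (i - 1 < m)%N by lia.
  have a_le j : (j < m)%N -> (a j <= l - 1)%N.
    by rewrite /a; case: ifP => // _; case: ifP.
  have a_sum : (\sum_(j < m) a j + 0 = t)%N by rewrite addn0 tE sum_step.
  have a_even j : (j.+1 < m)%N -> (0 < a j.+1)%N -> a j = (l - 1)%N.
    move=> _ aj; rewrite /a ifT //; move: aj; rewrite /a.
    by case: (ltngtP j.+1 (i - 1)%N) => // [/ltnW|<-].
  have lamE k' : lam k' = (expo (top_mono m n a 0) k')%:Z.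
    rewrite expo_top ffunE !omega_mulrn -PoszD /a; congr (_%:Z).
    case: (ltnP k' m) => k'm; case: (ltngtP k' (i - 1)%N) => k'i;
      case: (ltnP k' i) => k'i'; rewrite /= ?mul1n ?mul0n //; lia.
  have [v vE hw] := homog1_simple_hw q_neq0 q2_neq1 g l_char l_gt2 (leq0n n)
    a_le a_sum a_even (fun _ _ => False_ind _ \o notF) lamE.
  by split; [exists v | apply: simple_hw_iso_V hw].
move=> p t pn tE S lam.
set a := fun j : nat => _.
have a_sum : (\sum_(j < m) a j + p = t)%N by rewrite sum_nat_const card_ord tE.
have lamE i : lam i = (expo (top_mono m n a p) i)%:Z.
  rewrite expo_top ffunE omega_mulrn ffunE -PoszD /a; congr (_%:Z).
  by case: (ltnP i m) => im /=; lia.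
have [v vE hw] := homog1_simple_hw q_neq0 q2_neq1 g l_char l_gt2 pn
  (fun _ _ => leqnn _) a_sum (fun _ _ _ => erefl) (fun _ _ _ => erefl) lamE.
by split; [exists v | apply: simple_hw_iso_V hw].
Qed.
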